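(* Let $V\sim N(\mu,\gamma^2)$ with $\gamma>0$, let $\sigma>0$, and for $\kappa>0$ consider the equilibrium described in the context with penalty rate $c=\kappa\frac{\gamma}{\sigma}$. The insider's expected penalty in equilibrium, $P(\kappa):=\mathbb E\big[\frac c2\int_0^1(\alpha^*_t)^2dt\big]$, equals $$P(\kappa)=-\frac{\gamma\sigma}{2}\kappa\log(\kappa\Lambda(\kappa)).$$ There exists $\kappa_0\in(0,\infty)$ such that $P$ is concave on $(0,\kappa_0)$ and convex otherwise (i.e. on $(\kappa_0,\infty)$). In particular, $P$ is bounded by $\frac{\gamma\sigma}{2}$. Moreover, $P(0+)=P(\infty)=0$, i.e. $P(\kappa)\to0$ as $\kappa\to0+$ and as $\kappa\to\infty$.
   Context: For $\kappa>0$, $\Lambda(\kappa):=\frac{\sqrt{\kappa^2+4}-\kappa}{2}$. Let $B$ be a standard Brownian motion on $[0,1]$, $B_0=0$, independent of $V\sim N(\mu,\gamma^2)$, with expectation denoted $\mathbb E$. The equilibrium (of the continuous-time Kyle model with quadratic penalties at rate $c=\kappa\gamma/\sigma$) is as follows: the total demand $Y^*$ solves $$dY^*_t=\sigma\,dB_t+\alpha^*_t\,dt,\quad Y^*_0=0,\qquad \alpha^*_t=\Lambda(\kappa)\sigma\,\frac{\frac{V-\mu}{\gamma}-\frac{\Lambda(\kappa)Y^*_t}{\sigma}}{1-t\Lambda^2(\kappa)},$$ where $\alpha^*$ is the insider's trading rate; her accumulated penalty is $\frac c2\int_0^1(\alpha^*_t)^2dt$. *)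

(* Defs.v *)
From HB Require Import structures.
From mathcomp Require Import all_boot all_order all_algebra.
From mathcomp Require Import all_classical all_reals all_analysis.
Import numFieldNormedType.Exports.
Import Order.TTheory GRing.Theory Num.Theory.

Set Implicit Arguments.
Unset Strict Implicit.
Unset Printing Implicit Defensive.

Local Open Scope classical_set_scope.
Local Open Scope ring_scope.

Section stochastic_processes.
Context (d : measure_display) (T : measurableType d) (R : realType).
Variable P : probability T R.

Definition independent_systems (F G : set (set T)) : Prop :=
  forall A C : set T, F A -> G C -> (P (A `&` C) = P A * P C)%E.

Definition sigma_process (I : set R) (X : R -> T -> R) : set (set T) :=
  <<s \bigcup_(t in I) g_sigma_algebra_preimage (X t) >>.

(* [normal_prob] is parametrised by the standard deviation. Laws are compared
   on Borel sets only: the functions underlying two measures may differ on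
   non-measurable sets. *)
Definition has_normal_law (X : T -> R) (m s : R) : Prop :=
  forall A : set R, measurable A -> P (X @^-1` A) = normal_prob m s A.

(* Only the restriction of [B] to the time interval [0, 1] is constrained. *)
Record standard_brownian_motion (B : R -> {RV P >-> R}) : Prop := {
  bm_start : {ae P, forall w, B 0 w = 0};
  bm_increment_independent : forall s t : R, 0 <= s -> s < t -> t <= 1 ->
    independent_systems (sigma_process `[0, s] B)
      (g_sigma_algebra_preimage (fun w => B t w - B s w));
  bm_increment_normal : forall s t : R, 0 <= s -> s < t -> t <= 1 ->
    has_normal_law (fun w => B t w - B s w) 0 (Num.sqrt (t - s));
  bm_continuous : {ae P, forall w, {within `[0, 1], continuous (B ^~ w)}}
}.

End stochastic_processes.

Section kyle_equilibrium.
Context (R : realType).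

Definition Lambda (kappa : R) : R := (Num.sqrt (kappa ^+ 2 + 4) - kappa) / 2.

Definition penalty_rate (gamma sigma kappa : R) : R := kappa * (gamma / sigma).

Definition trading_rate (mu gamma sigma kappa v t y : R) : R :=
  Lambda kappa * sigma *
    (((v - mu) / gamma - Lambda kappa * y / sigma)
      / (1 - t * Lambda kappa ^+ 2)).

Context (d : measure_display) (T : measurableType d) (P : probability T R).

(* The diffusion coefficient is constant, so the stochastic integral in the
   integral form of the SDE is just [sigma * B t]. Path continuity makes the
   drift integrable on [0, t]. *)
Definition equilibrium_demand (mu gamma sigma kappa : R)
    (V : {RV P >-> R}) (B Y : R -> {RV P >-> R}) : Prop :=
  {ae P, forall w,
    [/\ Y 0 w = 0,
        {within `[0, 1], continuous (Y ^~ w)} &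
        forall t : R, 0 <= t -> t <= 1 ->
          Y t w = sigma * B t w +
            \int[lebesgue_measure]_(s in `[0, t])
              trading_rate mu gamma sigma kappa (V w) s (Y s w)]}.

Definition expected_penalty (mu gamma sigma kappa : R)
    (V : {RV P >-> R}) (Y : R -> {RV P >-> R}) : \bar R :=
  ('E_P[(fun w => penalty_rate gamma sigma kappa / 2 *
    \int[lebesgue_measure]_(t in `[0, 1])
      (trading_rate mu gamma sigma kappa (V w) t (Y t w)) ^+ 2)%R])%E.

End kyle_equilibrium.

(* Main.v *)
(* Write L for Lambda kappa, Z = (V - mu) / gamma and a t = 1 / (1 - t L^2). The
   rate is L sigma M_t with M_t = a t * (Z - L Y_t / sigma), and the drift of the
   demand cancels in dM = - L a dB, so M_t = Z - L \int_0^t a dB. Integration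
   against B is avoided: M_t is the pathwise limit of the Riemann sums
   Z - L \sum_k a(t_k) (B(t_{k+1}) - B(t_k)), whose second moments are explicit,
   and which Fatou's lemma turns into a limit in L^2. Hence E M_t^2 = a t, and
   integrating over [0, 1] and over the probability space (Tonelli) gives the
   penalty - gamma sigma / (2 L) * (1 - L^2) * ln (1 - L^2), which is the
   stated formula since kappa L = 1 - L^2.
   With w = sqrt (kappa^2 + 4), the second derivative of - kappa ln (kappa L) is
   - 1 / kappa + 1 / w + 4 / w^3; it has the sign of (kappa^2 + 2)^2 - 20. *)
Require Import Defs.
From HB Require Import structures.
From mathcomp Require Import all_boot all_order all_algebra.
From mathcomp Require Import all_classical all_reals all_analysis.
From mathcomp Require Import measurable_realfun ring lra.
Import numFieldNormedType.Exports.
Import Order.TTheory GRing.Theory Num.Theory.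

Set Implicit Arguments.
Unset Strict Implicit.
Unset Printing Implicit Defensive.

Local Open Scope classical_set_scope.
Local Open Scope ring_scope.

(** * Shape of the penalty *)

Section penalty_profile.
Context {R : realType}.
Implicit Type k : R.

(** The obstacle is measurability. The demand is a family of random variables with paths continuous
    only almost surely, the probability need not be complete, and nothing is assumed jointly in time
    and outcome. Tonelli therefore does not apply to the squared rate directly: a jointly measurable
    version is built by freezing time on grids, and integrals are compared with it almost
    everywhere, without measurability of the original integrand. For [kappa > 0] one has [L < 1], so
    [a] is bounded by [1 / (1 - L^2)] and Lipschitz on [[0, 1]], terminal time included. The error
    bounds rest on this: refining a grid of [n] cells moves the Riemann sum by [O(1/n)] in L^2 norm,
    and Fatou turns this into the same rate for the distance to [M_t]. The limit is identified
    outcome by outcome, from uniform continuity of [M]. The parameters [gamma] and [sigma] enter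
    only through the factor [gamma sigma / 2]. The remaining profile is at most [L], hence at most
    [1] and at most [1 / kappa]; near [0] it is [O(sqrt kappa)]. *)

Lemma sqrt_sqrD4_gt0 k : 0 < Num.sqrt (k ^+ 2 + 4).
Proof. by rewrite sqrtr_gt0 ltr_wpDl// sqr_ge0. Qed.

Lemma sqr_sqrt_sqrD4 k : Num.sqrt (k ^+ 2 + 4) ^+ 2 = k ^+ 2 + 4.
Proof. by rewrite sqr_sqrtr// addr_ge0// sqr_ge0. Qed.

Lemma Lambda_gt0 k : 0 < Lambda k.
Proof.
rewrite divr_gt0// subr_gt0 (le_lt_trans (ler_norm k))//.
rewrite -(ltr_pXn2r (n := 2)) ?nnegrE ?sqrtr_ge0//.
by rewrite real_normK ?num_real// sqr_sqrt_sqrD4 ltrDl.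
Qed.

(** [Lambda k] is the positive root of [x ^+ 2 + k * x = 1]; the bounds on it below use only this
    equation and positivity. *)
Lemma mul_Lambda k : k * Lambda k = 1 - Lambda k ^+ 2.
Proof. by have := sqr_sqrt_sqrD4 k; rewrite /Lambda; lra. Qed.

Lemma Lambda_lt1 k : 0 < k -> Lambda k < 1.
Proof.
move=> k0; have L0 := Lambda_gt0 k; have := mul_Lambda k.
have : 0 < k * Lambda k by rewrite mulr_gt0.
by move=> ? ?; nra.
Qed.

(** The penalty in units of [gamma * sigma / 2]. *)
Definition penalty_profile k : R := - (k * ln (k * Lambda k)).

Lemma is_derive_sqrt_sqrD4 k :
  is_derive k 1 (fun x : R => Num.sqrt (x ^+ 2 + 4))
    (k / Num.sqrt (k ^+ 2 + 4)).
Proof.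
have -> : k / Num.sqrt (k ^+ 2 + 4) = (2 * Num.sqrt (k ^+ 2 + 4))^-1 * (2 * k).
  by have := sqrt_sqrD4_gt0 k; set w := Num.sqrt _ => w0; field; lra.
apply: (@is_derive1_comp _ (@Num.sqrt R) (fun x => x ^+ 2 + 4)).
  by apply: is_derive1_sqrt; rewrite ltr_wpDl// sqr_ge0.
apply: is_derive_eq; rewrite /GRing.scale/=; ring.
Qed.

(** In this form the logarithmic derivative of [Lambda] is visibly [- 1 / sqrt (k ^+ 2 + 4)], so
    that [Lambda] disappears from the derivative of [ln (k * Lambda k)]. *)
Lemma is_derive_Lambda k :
  is_derive k 1 (@Lambda R) (- Lambda k / Num.sqrt (k ^+ 2 + 4)).
Proof.
have H := is_derive_sqrt_sqrD4 k.
have -> : @Lambda R = 2^-1 *: ((fun x => Num.sqrt (x ^+ 2 + 4)) - id).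
  by apply/funext => x; rewrite /Lambda /GRing.scale/= mulrC.
apply: is_derive_eq; rewrite /GRing.scale/= !fctE /GRing.scale/=.
have := sqrt_sqrD4_gt0 k; set w := Num.sqrt _ => w0. by field; lra.
Qed.

Definition penalty_profile1 k : R :=
  - ln (k * Lambda k) - 1 + k / Num.sqrt (k ^+ 2 + 4).

Lemma is_derive_ln_mul_Lambda k : 0 < k ->
  is_derive k 1 (fun x => ln (x * Lambda x))
    (k^-1 - (Num.sqrt (k ^+ 2 + 4))^-1).
Proof.
move=> k0; have L0 := Lambda_gt0 k; have w0 := sqrt_sqrD4_gt0 k.
have dL := is_derive_Lambda k.
have -> : k^-1 - (Num.sqrt (k ^+ 2 + 4))^-1 = (k * Lambda k)^-1 *
    (Lambda k + k * (- Lambda k / Num.sqrt (k ^+ 2 + 4))).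
  by move: L0 w0; set l := Lambda k; set w := Num.sqrt _ => *; field; lra.
apply: (@is_derive1_comp _ (@ln R) (fun x => x * Lambda x)).
  by apply: is_derive1_ln; rewrite mulr_gt0.
by apply: is_derive_eq; rewrite /GRing.scale/=; ring.
Qed.

Lemma is_derive_penalty_profile k : 0 < k ->
  is_derive k 1 penalty_profile (penalty_profile1 k).
Proof.
move=> k0; have H := is_derive_ln_mul_Lambda k0.
have -> : penalty_profile = - (id * (fun x => ln (x * Lambda x))) by [].
apply: is_derive_eq; rewrite /GRing.scale/= /penalty_profile1.
have := sqrt_sqrD4_gt0 k; set w := Num.sqrt _ => w0. by field; lra.
Qed.

Lemma is_derive_penalty_profile1 k : 0 < k ->
  is_derive k 1 penalty_profile1
    (- k^-1 + (Num.sqrt (k ^+ 2 + 4))^-1 + 4 / Num.sqrt (k ^+ 2 + 4) ^+ 3).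
Proof.
move=> k0; have H := is_derive_ln_mul_Lambda k0.
have H2 := is_derive_sqrt_sqrD4 k.
have w0 := sqrt_sqrD4_gt0 k.
have H3 : is_derive k 1 (fun x : R => (Num.sqrt (x ^+ 2 + 4))^-1)
   (- (Num.sqrt (k ^+ 2 + 4))^-2 *: (k / Num.sqrt (k ^+ 2 + 4)) : R).
  by apply: is_deriveV; rewrite gt_eqF.
have -> : penalty_profile1 = - (fun x => ln (x * Lambda x)) - cst 1 +
   id * (fun x : R => (Num.sqrt (x ^+ 2 + 4))^-1) by [].
apply: is_derive_eq; rewrite /GRing.scale/=.
have := sqr_sqrt_sqrD4 k; move: w0; set w := Num.sqrt _ => w0 w2.
have -> : (4 : R) = w ^+ 2 - k ^+ 2 by rewrite w2; ring.
by field; lra.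
Qed.

End penalty_profile.

(** * Convexity on an open interval from the second derivative *)

Section convex_function_itv.
Context {R : realType}.
Local Open Scope convex_scope.

(** Any two points of [D] span a segment inside [D], to which [second_derivative_convex] applies.
    Openness of [D] makes ['D_1 f] agree with [f1] near each point, so that [f2] is also the
    derivative of ['D_1 f]. *)
Lemma convex_function_is_derive2 (D : interval R) (f f1 f2 : R -> R) :
  open [set` D] ->
  (forall x, x \in D -> is_derive x 1 f (f1 x)) ->
  (forall x, x \in D -> is_derive x 1 f1 (f2 x)) ->
  (forall x, x \in D -> 0 <= f2 x) ->
  convex_function ([set` D] : set R) f.
Proof.
move=> oD df df1 f2_ge0.
have cf x : x \in D -> {for x, continuous f}.
  by move=> xD; apply/differentiable_continuous/derivable1_diffP; case: (df x xD).
have df' x : x \in D -> is_derive x 1 ('D_1 f : R -> R) (f2 x).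
  move=> xD; apply: (near_eq_is_derive (f := f1)); last exact: df1.
  near=> y; apply/esym; have yD : y \in D.
    by near: y; exact: (open_nbhs_nbhs (conj oD xD)).
  by have /@derive_val := df y yD.
have convex_lt (t : {i01 R}) (x y : R) : x \in D -> y \in D -> x < y ->
    (f ((x : R^o) <| t |> (y : R^o)) <= (f x : R^o) <| t |> (f y : R^o))%R.
  move=> xD yD xy.
  have xyD z : x < z < y -> z \in D.
    move=> /andP[xz zy]; apply: (@interval_is_interval _ D x y xD yD).
    by rewrite (ltW xz) (ltW zy).
  apply: second_derivative_convex; last exact: ltW.
  - move=> z /xyD zD; have /@derive_val -> := df' z zD; exact: f2_ge0.
  - exact/cvg_at_left_filter/cf.
  - exact/cvg_at_right_filter/cf.
  - by move=> z /[!in_itv]/= /xyD zD; case: (df z zD).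
  - by move=> z /[!in_itv]/= /xyD zD; case: (df' z zD).
move=> t x y /[!inE]/= xD yD; have [xy|yx|->] := ltgtP x y.
- exact: convex_lt.
- by rewrite convC [leRHS]convC; exact: convex_lt.
- by rewrite !convmm.
Unshelve. all: by end_near. Qed.

(** The penalty is a multiple of the profile for positive [kappa] only. Agreement on the interval
    suffices because convex combinations of its points stay in it. *)
Lemma eq_convex_function_itv (D : interval R) (f g : R -> R) :
  {in D, f =1 g} ->
  convex_function ([set` D] : set R) f -> convex_function ([set` D] : set R) g.
Proof.
move=> fg cf t x y /[dup] + /[!inE]/= xD /[dup] + /[!inE]/= yD.
move=> /[!inE] /= _ _; rewrite -!fg//.
  by apply: cf; rewrite inE.
wlog xy : t x y xD yD / x <= y.
  move=> h; have [|/ltW] := leP x y; first exact: h.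
  by rewrite convC; exact: h.
by have /itvP xty := convR_itv t xy; apply: (@interval_is_interval _ D x y xD yD);
  rewrite !xty.
Qed.

Lemma convex_function_scale (D : set R) (c : R) (f : R -> R) : 0 <= c ->
  convex_function D f -> convex_function D (fun x => c * f x).
Proof.
move=> c0 cf t x y xD yD; have := ler_wpM2l c0 (cf t x y xD yD).
by congr (_ <= _); rewrite !convRE mulrDr !mulrA ![c * _]mulrC.
Qed.

End convex_function_itv.

(** * Inflection point, bounds and limits of the profile *)

Section penalty_profile_properties.
Context {R : realType}.
Implicit Type k : R.

(* the positive root of [(x ^+ 2 + 2) ^+ 2 = 20] *)
Definition inflection : R := Num.sqrt (2 * Num.sqrt 5 - 2).

Lemma sqr_sqrt5 : (Num.sqrt 5 : R) ^+ 2 = 5.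
Proof. by rewrite sqr_sqrtr. Qed.

Lemma sqrt5_gt1 : 1 < Num.sqrt 5 :> R.
Proof. by rewrite -[ltLHS]sqrtr1 ltr_sqrt// ltr1n. Qed.

Lemma inflection_gt0 : 0 < inflection.
Proof. by rewrite sqrtr_gt0; have := sqrt5_gt1; lra. Qed.

Lemma sqr_inflection : inflection ^+ 2 = 2 * Num.sqrt 5 - 2.
Proof. by rewrite sqr_sqrtr//; have := sqrt5_gt1; lra. Qed.

Definition penalty_profile2 k : R :=
  - k^-1 + (Num.sqrt (k ^+ 2 + 4))^-1 + 4 / Num.sqrt (k ^+ 2 + 4) ^+ 3.

(** With [w = sqrt (k^2 + 4)] the numerator over [k w^3] is [k (k^2 + 8) - w^3]. Multiplying by the
    conjugate removes the root: [k^2 (k^2 + 8)^2 - (k^2 + 4)^3 = 4 ((k^2 + 2)^2 - 20)]. *)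
Lemma penalty_profile2E k : 0 < k -> penalty_profile2 k =
  4 * ((k ^+ 2 + 2) ^+ 2 - 20) /
  (k * Num.sqrt (k ^+ 2 + 4) ^+ 3 *
    (k * (k ^+ 2 + 8) + Num.sqrt (k ^+ 2 + 4) ^+ 3)).
Proof.
move=> k0; rewrite /penalty_profile2.
have := sqr_sqrt_sqrD4 k; have := sqrt_sqrD4_gt0 k; set w := Num.sqrt _ => w0 w2.
have w3 : 0 < w ^+ 3 by rewrite exprn_gt0.
have kw : 0 < k * (k ^+ 2 + 8) by rewrite mulr_gt0// ltr_wpDl// sqr_ge0.
have -> : 4 * ((k ^+ 2 + 2) ^+ 2 - 20) =
    (k * (k ^+ 2 + 8) - w ^+ 3) * (k * (k ^+ 2 + 8) + w ^+ 3).
  have -> : (k * (k ^+ 2 + 8) - w ^+ 3) * (k * (k ^+ 2 + 8) + w ^+ 3) =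
    (k * (k ^+ 2 + 8)) ^+ 2 - (w ^+ 2) ^+ 3 by ring.
  by rewrite w2; ring.
rewrite -mulf_div divff ?mulr1 ?gt_eqF ?addr_gt0//.
have -> : k ^+ 2 + 8 = w ^+ 2 + 4 by rewrite w2; ring.
by field; rewrite !gt_eqF.
Qed.

Let denominator_gt0 k : 0 < k -> 0 < k * Num.sqrt (k ^+ 2 + 4) ^+ 3 *
    (k * (k ^+ 2 + 8) + Num.sqrt (k ^+ 2 + 4) ^+ 3).
Proof.
move=> k0; have w3 : 0 < Num.sqrt (k ^+ 2 + 4) ^+ 3.
  by rewrite exprn_gt0// sqrt_sqrD4_gt0.
have kw : 0 < k * (k ^+ 2 + 8) by rewrite mulr_gt0// ltr_wpDl// sqr_ge0.
by apply: mulr_gt0; [exact: mulr_gt0|exact: addr_gt0].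
Qed.

Lemma penalty_profile2_le0 k : 0 < k < inflection -> penalty_profile2 k <= 0.
Proof.
move=> /andP[k0 ki]; rewrite penalty_profile2E//.
rewrite ler_pdivrMr ?mul0r; last exact: denominator_gt0.
have : k ^+ 2 < inflection ^+ 2 by rewrite ltr_pXn2r ?nnegrE// ltW// inflection_gt0.
rewrite sqr_inflection => h; have := sqr_sqrt5; have := sqrt5_gt1.
move: h; set r := Num.sqrt 5; have := sqr_ge0 k; set x := k ^+ 2 => *; nra.
Qed.

Lemma penalty_profile2_ge0 k : inflection < k -> 0 <= penalty_profile2 k.
Proof.
move=> ik; have k0 := lt_trans inflection_gt0 ik; rewrite penalty_profile2E//.
rewrite divr_ge0//; last exact/ltW/denominator_gt0.
have : inflection ^+ 2 < k ^+ 2 by rewrite ltr_pXn2r ?nnegrE// ltW// inflection_gt0.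
rewrite sqr_inflection => h; have := sqr_sqrt5; have := sqrt5_gt1.
move: h; set r := Num.sqrt 5; set x := k ^+ 2 => *; nra.
Qed.

Lemma concave_penalty_profile :
  convex_function (`]0, inflection[ : set R) (fun k => - penalty_profile k).
Proof.
apply: (@convex_function_is_derive2 _ `]0, inflection[
  _ (- penalty_profile1) (- penalty_profile2)).
- exact: interval_open.
- move=> x /[!in_itv]/= /andP[x0 _].
  by have := is_derive_penalty_profile x0; exact: is_deriveN.
- move=> x /[!in_itv]/= /andP[x0 _].
  by have := is_derive_penalty_profile1 x0; exact: is_deriveN.
- by move=> x /[!in_itv]/= xi; rewrite oppr_ge0 penalty_profile2_le0.
Qed.

Lemma convex_penalty_profile :
  convex_function (`]inflection, +oo[ : set R) penalty_profile.
Proof.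
have i0 := inflection_gt0.
apply: (@convex_function_is_derive2 _ `]inflection, +oo[
  _ penalty_profile1 penalty_profile2).
- exact: interval_open.
- move=> x /[!in_itv]/=; rewrite andbT => ix.
  exact/is_derive_penalty_profile/(lt_trans i0).
- move=> x /[!in_itv]/=; rewrite andbT => ix.
  exact/is_derive_penalty_profile1/(lt_trans i0).
- by move=> x /[!in_itv]/=; rewrite andbT => /penalty_profile2_ge0.
Qed.

Lemma penalty_profile_ge0 k : 0 < k -> 0 <= penalty_profile k.
Proof.
move=> k0; rewrite oppr_ge0 mulr_ge0_le0 ?(ltW k0)// ln_le0// mul_Lambda.
by have := sqr_ge0 (Lambda k); lra.
Qed.

(** From [- ln u <= 1 / u - 1] at [u = k L]: multiplied by [k], the right side is
    [(1 - k L) / L = L^2 / L = L]. Both the uniform bound and the decay at infinity follow. *)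
Lemma penalty_profile_le_Lambda k : 0 < k -> penalty_profile k <= Lambda k.
Proof.
move=> k0; have L0 := Lambda_gt0 k; have L1 := Lambda_lt1 k0.
set u := k * Lambda k; have u0 : 0 < u by rewrite mulr_gt0.
have : ln u^-1 <= u^-1 - 1.
  rewrite -[X in ln X](subrKC 1); apply: le_ln1Dx.
  by have : 0 < u^-1; [rewrite invr_gt0|lra].
rewrite lnV ?posrE// /penalty_profile -/u -mulrN => /(ler_wpM2l (ltW k0)).
move=> /le_trans; apply; rewrite le_eqVlt; apply/orP; left; apply/eqP.
have -> : k * (u^-1 - 1) = (1 - k * Lambda k) / Lambda k.
  by rewrite /u; field; rewrite !gt_eqF.
by rewrite mul_Lambda; field; rewrite gt_eqF.
Qed.

Lemma penalty_profile_le1 k : 0 < k -> penalty_profile k <= 1.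
Proof.
by move=> k0; exact: le_trans (penalty_profile_le_Lambda k0) (ltW (Lambda_lt1 k0)).
Qed.

Lemma Lambda_le_inv k : 0 < k -> Lambda k <= k^-1.
Proof.
move=> k0; rewrite -(ler_pM2l k0) divff ?gt_eqF// mul_Lambda.
by have := sqr_ge0 (Lambda k); lra.
Qed.

Lemma cvg_penalty_profile_pinfty : @penalty_profile R k @[k --> +oo] --> 0.
Proof.
apply: (squeeze_cvgr (f := cst 0) (h := fun k => k^-1)).
- near=> k; have k0 : 0 < k by near: k; exact: nbhs_pinfty_gt.
  by rewrite penalty_profile_ge0//= (le_trans (penalty_profile_le_Lambda k0))// Lambda_le_inv.
- exact: cvg_cst.
- by apply/gtr0_cvgV0; [near=> k; near: k; exact: nbhs_pinfty_gt|exact: cvg_id].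
Unshelve. all: by end_near. Qed.

(** For [k <= 1] the equation gives [L^2 >= 1 - L], which fails below [1 / 4]. The value is not
    sharp; it is chosen for its square root [1 / 2]. *)
Lemma Lambda_ge_quarter k : 0 < k <= 1 -> 1 / 4 <= Lambda k.
Proof.
move=> /andP[k0 k1]; have := mul_Lambda k; have := Lambda_gt0 k; set L := Lambda k.
by move=> *; nra.
Qed.

(* [- ln u <= 2 / sqrt u] at [u = k Lambda k] *)
Lemma penalty_profile_le_sqrt k : 0 < k <= 1 -> penalty_profile k <= 4 * Num.sqrt k.
Proof.
move=> /[dup] k01 /andP[k0 k1]; have L0 := Lambda_gt0 k.
have s0 : 0 < Num.sqrt k by rewrite sqrtr_gt0.
have l0 : 0 < Num.sqrt (Lambda k) by rewrite sqrtr_gt0.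
have l2 : 1 / 2 <= Num.sqrt (Lambda k).
  rewrite -(ler_pXn2r (n := 2)) ?nnegrE ?sqrtr_ge0//.
  rewrite sqr_sqrtr ?(ltW L0)// (_ : (1 / 2) ^+ 2 = 1 / 4 :> R); last by field.
  exact: Lambda_ge_quarter.
set r := Num.sqrt k * Num.sqrt (Lambda k).
have r0 : 0 < r by rewrite mulr_gt0.
have uE : k * Lambda k = r ^+ 2 by rewrite exprMn !sqr_sqrtr// ltW.
have lnr : - ln r < r^-1 by rewrite -lnV ?posrE// ln_sublinear// invr_gt0.
rewrite /penalty_profile uE lnXn// -mulrN -mulNrn mulr2n.
have -> : k = Num.sqrt k ^+ 2 by rewrite sqr_sqrtr// ltW.
have -> : Num.sqrt (Num.sqrt k ^+ 2) = Num.sqrt k by rewrite sqrtr_sqr ger0_norm// ltW.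
have h : Num.sqrt k ^+ 2 * (- ln r - ln r) <= Num.sqrt k ^+ 2 * (r^-1 + r^-1).
  by rewrite ler_pM2l ?exprn_gt0//; lra.
apply: (le_trans h); rewrite /r.
have -> : Num.sqrt k ^+ 2 * ((Num.sqrt k * Num.sqrt (Lambda k))^-1 +
    (Num.sqrt k * Num.sqrt (Lambda k))^-1) =
    2 * Num.sqrt k / Num.sqrt (Lambda k) by field; rewrite !gt_eqF.
by rewrite ler_pdivrMr//; nra.
Qed.

Lemma cvg_penalty_profile_at_right0 : @penalty_profile R k @[k --> 0^'+] --> 0.
Proof.
apply: (squeeze_cvgr (f := cst 0) (h := fun k => 4 * Num.sqrt k)).
- near=> k; have k0 : 0 < k by near: k; exact: nbhs_right_gt.
  rewrite penalty_profile_ge0//= penalty_profile_le_sqrt// k0/=.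
  by near: k; exact: nbhs_right_le.
- exact: cvg_cst.
- apply: cvg_at_right_filter; rewrite -[X in _ --> X](mulr0 4).
  by apply: cvgMr; rewrite -[X in _ --> X](@sqrtr0 R); exact: sqrt_continuous.
Unshelve. all: by end_near. Qed.

End penalty_profile_properties.

(** * Gaussian moments *)

Section integral_density.
Context d (T : measurableType d) (R : realType).
Variables (mu nu : {measure set T -> \bar R}) (p : T -> R).
Hypothesis mp : measurable_fun [set: T] p.
Hypothesis p_ge0 : forall x, 0 <= p x.
Hypothesis nuE : forall A, measurable A ->
  nu A = (\int[mu]_(x in A) (p x)%:E)%E.
Import HBNNSimple.
Local Open Scope ereal_scope.

Let integral_density_nnsfun (h : {nnsfun T >-> R}) :
  \int[nu]_x (h x)%:E = \int[mu]_x ((h x)%:E * (p x)%:E).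
Proof.
under [LHS]eq_integral do rewrite fimfunE -fsumEFin//.
rewrite [LHS]ge0_integral_fsum//; last 2 first.
  - by move=> r; exact/measurable_EFinP/measurableT_comp.
  - by move=> n x _; rewrite EFinM nnfun_muleindic_ge0.
under [RHS]eq_integral.
  move=> x _; rewrite fimfunE -fsumEFin// muleC ge0_mule_fsumr; last first.
    by move=> r; rewrite EFinM nnfun_muleindic_ge0.
  over.
rewrite [RHS]ge0_integral_fsum//; last 2 first.
  - move=> r; apply: emeasurable_funM; first exact/measurable_EFinP.
    exact/measurable_EFinP/measurableT_comp.
  - move=> r x _; apply: mule_ge0; first by rewrite lee_fin.
    by rewrite EFinM nnfun_muleindic_ge0.
apply: eq_fsbigr => r /[!inE] -[t _ htr].
have r0 : (0 <= r)%R by rewrite -htr.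
have mr : measurable (h @^-1` [set r]) by [].
rewrite integralZl_indic_nnsfun//= integral_indic//= setIT nuE//.
rewrite integral_mkcond.
rewrite -ge0_integralZl//=.
- apply: eq_integral => x _; rewrite EFinM muleCA patchE indicE.
  by case: (x \in _) => /=; rewrite ?mulr1n ?mule1 ?mulr0n ?mule0.
- apply/(measurable_restrictT _ _).1 => //.
  exact/measurable_funTS/measurable_EFinP.
- by move=> x _; rewrite patchE; case: ifPn; rewrite ?lee_fin.
Qed.

(** The identity holds for simple functions and passes to [f] by monotone convergence. The density
    is prescribed on measurable sets only, which is how [has_normal_law] is stated. *)
Lemma ge0_integral_density (f : T -> \bar R) :
  measurable_fun [set: T] f -> (forall x, 0 <= f x) ->
  \int[nu]_x f x = \int[mu]_x (f x * (p x)%:E).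
Proof.
move=> mf f0; pose f_ := nnsfun_approx measurableT mf.
have fE x : f x = limn (fun n => (f_ n x)%:E).
  by apply/esym/cvg_lim => //; exact: cvg_nnsfun_approx.
transitivity (limn (fun n => \int[nu]_x (f_ n x)%:E)).
  rewrite -monotone_convergence//=; first by apply: eq_integral => x _.
  - by move=> n; exact/measurable_EFinP.
  - by move=> n x _; rewrite lee_fin.
  - by move=> x _ m n mn; rewrite lee_fin; exact/lefP/nd_nnsfun_approx.
under eq_fun do rewrite integral_density_nnsfun.
rewrite -monotone_convergence//=.
- apply: eq_integral => x _; rewrite [in RHS]fE muleC -limeMl//.
    by apply/congr_lim/funext => n; rewrite muleC.
  apply/ereal_nondecreasing_is_cvgn => m n mn.
  by rewrite lee_fin; exact/lefP/nd_nnsfun_approx.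
- by move=> n; apply: emeasurable_funM; exact/measurable_EFinP.
- by move=> n x _; rewrite mule_ge0// lee_fin.
- move=> x _ m n mn; apply: lee_wpmul2r; rewrite ?lee_fin//.
  exact/lefP/nd_nnsfun_approx.
Qed.

End integral_density.

Section gaussian_moments.
Import gauss_integral_proof.
Context {R : realType}.
Local Notation mu := (@lebesgue_measure R).

Lemma cvg_integral0_gauss : integral0_gauss x @[x --> +oo] --> (Num.sqrt pi / 2 : R).
Proof.
have : Num.sqrt (@integral0_gauss R x ^+ 2) @[x --> +oo]
    --> Num.sqrt (pi / 4 : R).
  by apply: continuous_cvg => //; [exact: sqrt_continuous|exact: cvg_integral0_gauss_sqr].
rewrite sqrtrM ?pi_ge0// sqrtrV// (_ : 4 = 2 ^+ 2); last by rewrite expr2 -natrM.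
rewrite sqrtr_sqr ger0_norm//.
by under eq_fun do rewrite sqrtr_sqr ger0_norm ?integral0_gauss_ge0//.
Qed.

(** The boundary term at infinity in the second moment; [expR (x ^+ 2) >= 1 + x ^+ 2] bounds it by
    [1 / x]. *)
Lemma cvg_mul_gauss_fun : x * gauss_fun x @[x --> +oo] --> (0 : R).
Proof.
apply: (squeeze_cvgr (f := cst 0) (h := fun x => x^-1)).
- near=> x; have x0 : 0 < x by near: x; exact: nbhs_pinfty_gt.
  rewrite mulr_ge0 ?gauss_fun_ge0 ?(ltW x0)//=.
  rewrite /gauss_fun expRN ler_pdivrMr ?expR_gt0//.
  have := expR_ge1Dx (x ^+ 2) => h.
  rewrite -(ler_pM2l x0) mulrA divff ?gt_eqF// mul1r -expr2.
  by apply: le_trans h; rewrite lerDr.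
- exact: cvg_cst.
- by apply/gtr0_cvgV0; [near=> x; near: x; exact: nbhs_pinfty_gt|exact: cvg_id].
Unshelve. all: by end_near. Qed.

Lemma is_derive_gauss_fun (x : R) :
  is_derive x 1 (@gauss_fun R) (- (2 * x) * gauss_fun x).
Proof.
have -> : - (2 * x) * gauss_fun x = expR (- x ^+ 2) * (- (2 * x)) by rewrite mulrC.
apply: (@is_derive1_comp _ (@expR R) (fun x => - x ^+ 2)).
by apply: is_derive_eq; rewrite /GRing.scale/=; ring.
Qed.

Lemma is_derive_integral0_gauss (x : R) : 0 < x ->
  is_derive x 1 (@integral0_gauss R) (gauss_fun x).
Proof.
move=> x0; have xx1 : x < x + 1 by rewrite ltrDl.
have [] := @continuous_FTC1_closed R gauss_fun 0 x (x + 1) xx1 _ x0 (@continuous_gauss_fun R x).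
  apply: continuous_compact_integrable; first exact: segment_compact.
  by apply: continuous_subspaceT; exact: continuous_gauss_fun.
by rewrite derive1E => dF <-; exact/derivableP.
Qed.

Lemma integral0y_sqr_gauss :
  (\int[mu]_(x in `[0%R, +oo[) (x ^+ 2 * gauss_fun x)%:E = (Num.sqrt pi / 4)%:E)%E.
Proof.
(* [(x * gauss_fun x)' = gauss_fun x - 2 x ^+ 2 * gauss_fun x] *)
pose F (x : R) := (integral0_gauss x - x * gauss_fun x) / 2.
have dF (x : R) : 0 < x -> is_derive x 1 F (x ^+ 2 * gauss_fun x).
  move=> x0; have H1 := is_derive_integral0_gauss x0.
  have H2 := is_derive_gauss_fun x.
  have -> : F = 2^-1 *: (integral0_gauss - id * @gauss_fun R).
    by apply/funext => y; rewrite /F /GRing.scale/= mulrC.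
  apply: is_derive_eq; rewrite /GRing.scale/= /GRing.scale/=.
  by field.
have c : continuous (fun x : R => x ^+ 2 * gauss_fun x).
  move=> x; apply: cvgM; [exact: exprn_continuous|exact: continuous_gauss_fun].
rewrite (@ge0_continuous_FTC2y R _ F 0 (Num.sqrt pi / 4)).
- rewrite /F mul0r subr0 /integral0_gauss set_itv1 Rintegral_set1 mul0r.
  by rewrite sube0.
- by move=> x _; rewrite mulr_ge0 ?sqr_ge0 ?gauss_fun_ge0.
- exact: continuous_subspaceT.
- have -> : Num.sqrt pi / 4 = (Num.sqrt pi / 2 - 0) / 2 :> R by field.
  apply: cvgMl; apply: cvgB; [exact: cvg_integral0_gauss|exact: cvg_mul_gauss_fun].
- by move=> x x0; case: (dF x x0).
- rewrite /F; apply: cvgMl; apply: cvgB.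
    have c0 : {within `[0, 1], continuous (@integral0_gauss R)}.
      apply: parameterized_integral_continuous => //=.
      apply: continuous_compact_integrable => //; first exact: segment_compact.
      by apply: continuous_subspaceT; exact: continuous_gauss_fun.
    by have /continuous_within_itvP - /(_ ltr01)[] := c0.
  apply: cvg_at_right_filter.
  by apply: cvgM; [exact: cvg_id|exact: continuous_gauss_fun].
- move=> x /[!in_itv]/=; rewrite andbT => x0; rewrite derive1E.
  by have /@derive_val := dF x x0.
Qed.

Lemma integralT_sqr_gauss :
  (\int[mu]_x (x ^+ 2 * gauss_fun x)%:E = (Num.sqrt pi / 2)%:E)%E.
Proof.
rewrite ge0_symfun_integralT//=.
- rewrite (_ : [set x | _] = `[0, +oo[%classic); last first.
    by apply/seteqP; split => x/=; rewrite in_itv/= andbT.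
  by rewrite integral0y_sqr_gauss -EFinM; congr EFin; field.
- by move=> x; rewrite mulr_ge0 ?sqr_ge0 ?gauss_fun_ge0.
- move=> x; apply: cvgM; [exact: exprn_continuous|exact: continuous_gauss_fun].
- by move=> x/=; rewrite /gauss_fun !sqrrN.
Qed.

(** The substitution [y = (x - m) / (s sqrt 2)] turns the density into [expR (- y ^+ 2) / sqrt pi];
    the factor [2 s^2] in [G] comes from [(x - m)^2]. *)
Lemma integral_sqr_normal_pdf (m s : R) : 0 < s ->
  (\int[mu]_x ((x - m) ^+ 2 * normal_pdf m s x)%:E = (s ^+ 2)%:E)%E.
Proof.
move=> s0; have q0 : 0 < Num.sqrt 2 :> R by rewrite sqrtr_gt0.
have p0 : 0 < Num.sqrt pi :> R by rewrite sqrtr_gt0 pi_gt0.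
have q2 : Num.sqrt 2 ^+ 2 = 2 :> R by rewrite sqr_sqrtr.
pose c := (s * Num.sqrt 2)^-1.
have c0 : 0 < c by rewrite invr_gt0 mulr_gt0.
pose F (x : R) := (x - m) * c.
pose G (y : R) := 2 * s ^+ 2 / Num.sqrt pi * (y ^+ 2 * gauss_fun y).
have dF (x : R) : is_derive x 1 F c.
  have -> : F = c *: (id - cst m).
    by apply/funext => y; rewrite /F /GRing.scale/= mulrC.
  by apply: is_derive_eq; rewrite /GRing.scale/= subr0 mulr1.
have F'E : F^`()%classic = cst c.
  by apply/funext => x; rewrite derive1E; have /@derive_val := dF x.
have cG0 : continuous (fun x : R => x ^+ 2 * gauss_fun x).
  move=> x; apply: cvgM; [exact: exprn_continuous|exact: continuous_gauss_fun].
have mG : measurable_fun [set: R] (fun x : R => x ^+ 2 * gauss_fun x).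
  exact: continuous_measurable_fun.
have C0 : 0 <= 2 * s ^+ 2 / Num.sqrt pi.
  by rewrite divr_ge0 ?mulr_ge0 ?sqr_ge0// ltW.
have G0 y : 0 <= G y.
  by rewrite mulr_ge0// mulr_ge0 ?sqr_ge0 ?gauss_fun_ge0.
transitivity (\int[mu]_y (G y)%:E)%E; last first.
  under eq_integral do rewrite EFinM.
  rewrite ge0_integralZl_EFin//= ?integralT_sqr_gauss.
  - rewrite -EFinM; congr EFin; field; by rewrite gt_eqF.
  - by move=> x _; rewrite lee_fin mulr_ge0 ?sqr_ge0 ?gauss_fun_ge0.
  - exact/measurable_EFinP.
rewrite (@increasing_ge0_integration_by_substitutionT _ F G)//.
- apply: eq_integral => x _; rewrite F'E; congr EFin; rewrite !fctE /= /G /F.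
  rewrite normal_pdfE ?gt_eqF// /normal_peak /normal_fun /gauss_fun.
  rewrite (_ : Num.sqrt (s ^+ 2 * pi *+ 2) = s * Num.sqrt pi * Num.sqrt 2); last first.
    have pi0 := pi_ge0 R; have ss0 := sqr_ge0 s.
    rewrite -mulr_natr (sqrtrM 2 (mulr_ge0 ss0 pi0)) (sqrtrM pi ss0).
    by rewrite sqrtr_sqr ger0_norm// ltW.
  rewrite (_ : ((x - m) * c) ^+ 2 = (x - m) ^+ 2 / (s ^+ 2 *+ 2)); last first.
    by rewrite exprMn /c exprVn exprMn q2 mulr_natr.
  rewrite mulNr /c -mulr_natr; set e := expR _.
  by field; rewrite !gt_eqF.
- by move=> x y xy; rewrite /F ltr_pM2r// ltrD2r.
- by rewrite F'E => x; exact: cvg_cst.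
- by rewrite F'E; exact: is_cvg_cst.
- by rewrite F'E; exact: is_cvg_cst.
- by apply/gt0_cvgMlNy => //; exact: cvg_addrr_Ny.
- by apply/gt0_cvgMly => //; exact: cvg_addrr.
- by move=> x; apply: cvgMr; exact: cG0.
Qed.

End gaussian_moments.

(** * Square integrable random variables *)

Section square_integrable_functions.
Context d (T : measurableType d) (R : realType) (P : probability T R).
Implicit Types X Y : T -> R.

(** A predicate on plain functions, so that sums and limits need not be packed as random
    variables. *)
Definition square_integrable X :=
  measurable_fun [set: T] X /\
  P.-integrable [set: T] (fun w => (X w ^+ 2)%:E).

Local Notation L2 := square_integrable.

(** [(|X| - |Y|)^2 >= 0] makes [X^2 + Y^2] dominate [|X Y|]. *)
Lemma L2_integrableM X Y : L2 X -> L2 Y ->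
  P.-integrable [set: T] (fun w => (X w * Y w)%:E).
Proof.
move=> [mX iX] [mY iY].
apply: le_integrable (integrableD measurableT iX iY) => //.
  by apply/measurable_EFinP/measurable_funM.
move=> w _ /=; rewrite lee_fin [leRHS]ger0_norm ?addr_ge0 ?sqr_ge0// normrM.
have := sqr_ge0 (`|X w| - `|Y w|).
rewrite -(real_normK (num_real (X w))) -(real_normK (num_real (Y w))).
have := normr_ge0 (X w); have := normr_ge0 (Y w).
by set a := `|X w|; set b := `|Y w| => *; nra.
Qed.

Lemma L2_cst (c : R) : L2 (cst c).
Proof.
split => //; exact: (@finite_measure_integrable_cst _ _ _ P _ (c ^+ 2)).
Qed.

Lemma L2_integrable X : L2 X -> P.-integrable [set: T] (EFin \o X).
Proof.
move=> X2; have := L2_integrableM X2 (L2_cst 1).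
by apply: eq_integrable => // w _ /=; rewrite mulr1.
Qed.

Lemma L2D X Y : L2 X -> L2 Y -> L2 (fun w => X w + Y w).
Proof.
move=> X2 Y2; split; first exact: measurable_funD X2.1 Y2.1.
have XY := L2_integrableM X2 Y2.
have := integrableD measurableT (integrableD measurableT X2.2 Y2.2)
  (integrableD measurableT XY XY).
apply: eq_integrable => // w _ /=.
by rewrite -!EFinD; congr EFin; ring.
Qed.

Lemma L2Z (c : R) X : L2 X -> L2 (fun w => c * X w).
Proof.
move=> X2; split; first by apply: measurable_funM => //; exact: X2.1.
have := integrableZl measurableT (c ^+ 2) X2.2.
by apply: eq_integrable => // w _ /=; rewrite -EFinM exprMn.
Qed.

Lemma L2B X Y : L2 X -> L2 Y -> L2 (fun w => X w - Y w).
Proof.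
move=> X2 Y2; have := L2D X2 (L2Z (-1) Y2).
by congr L2; apply/funext => w; rewrite mulN1r.
Qed.

Lemma L2_sum (f : nat -> R) (X : nat -> T -> R) n :
  (forall k, (k < n)%N -> L2 (X k)) ->
  L2 (fun w => \sum_(0 <= k < n) f k * X k w).
Proof.
elim: n => [|n IHn] X2.
  by under eq_fun do rewrite big_nil; exact: L2_cst.
under eq_fun do rewrite big_nat_recr//=.
apply: L2D; first by apply: IHn => k kn; apply: X2; exact: ltnW.
exact/L2Z/X2.
Qed.

Lemma RintegralM_sum (f : nat -> R) (X : nat -> T -> R) Y n :
  (forall k, (k < n)%N -> L2 (X k)) -> L2 Y ->
  \int[P]_w ((\sum_(0 <= k < n) f k * X k w) * Y w) =
  \sum_(0 <= k < n) f k * \int[P]_w (X k w * Y w).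
Proof.
move=> + Y2; elim: n => [|n IHn] X2.
  under eq_Rintegral do rewrite big_nil mul0r.
  by rewrite big_nil Rintegral_cst// mul0r.
rewrite big_nat_recr//= -IHn; last by move=> k kn; apply: X2; exact: ltnW.
rewrite -RintegralZl//; last exact: L2_integrableM (X2 n _) Y2.
rewrite -RintegralD//.
- by apply: eq_Rintegral => w _; rewrite big_nat_recr//= mulrDl mulrA.
- apply: L2_integrableM => //.
  by apply: L2_sum => k kn; apply: X2; exact: ltnW.
- have := L2_integrableM (L2Z (f n) (X2 n (leqnn _))) Y2.
  by apply: eq_integrable => // w _ /=; rewrite mulrA.
Qed.

Lemma RintegralD_sqr X Y : L2 X -> L2 Y ->
  \int[P]_w ((X w + Y w) ^+ 2) =
  \int[P]_w (X w ^+ 2) + 2 * \int[P]_w (X w * Y w) + \int[P]_w (Y w ^+ 2).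
Proof.
move=> X2 Y2; have XY := L2_integrableM X2 Y2.
have XY2 := integrableZl measurableT 2 XY.
rewrite -RintegralZl// -RintegralD//; last exact: X2.2.
rewrite -RintegralD//; [|exact: (integrableD measurableT X2.2 XY2)|exact: Y2.2].
by apply: eq_Rintegral => w _; ring.
Qed.

(** Pythagoras, by induction: the new term is orthogonal to the partial sum. The common second
    moment [v] is the cell length of a uniform grid in the application. *)
Lemma Rintegral_sqr_orthogonal_sum (f : nat -> R) (X : nat -> T -> R) (v : R) n :
  (forall k, (k < n)%N -> L2 (X k)) ->
  (forall j k, (j < k < n)%N -> \int[P]_w (X j w * X k w) = 0) ->
  (forall k, (k < n)%N -> \int[P]_w (X k w ^+ 2) = v) ->
  \int[P]_w ((\sum_(0 <= k < n) f k * X k w) ^+ 2) =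
  \sum_(0 <= k < n) f k ^+ 2 * v.
Proof.
elim: n => [|n IHn] X2 X0 Xv.
  under eq_Rintegral do rewrite big_nil expr0n.
  by rewrite big_nil Rintegral_cst// mul0r.
have X2' k : (k < n)%N -> L2 (X k) by move=> kn; apply: X2; exact: ltnW.
rewrite big_nat_recr//= -IHn//; last 2 first.
- by move=> j k /andP[jk kn]; apply: X0; rewrite jk ltnW.
- by move=> k kn; apply: Xv; exact: ltnW.
under eq_Rintegral do rewrite big_nat_recr//=.
rewrite RintegralD_sqr; [|exact: L2_sum|exact/L2Z/X2].
have -> : \int[P]_w ((\sum_(0 <= i < n) f i * X i w) * (f n * X n w)) = 0.
  rewrite RintegralM_sum//; last exact/L2Z/X2.
  rewrite big_nat big1// => k /andP[_ kn].
  have -> : \int[P]_w (X k w * (f n * X n w)) = f n * \int[P]_w (X k w * X n w).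
    rewrite -RintegralZl//; last exact: L2_integrableM (X2' k kn) (X2 n _).
    by apply: eq_Rintegral => w _; rewrite mulrCA.
  by rewrite X0 ?mulr0// kn ltnSn.
rewrite mulr0 addr0; congr (_ + _).
rewrite -(Xv n)// -RintegralZl//; last by have [] := X2 n (leqnn _).
by apply: eq_Rintegral => w _; rewrite exprMn.
Qed.

End square_integrable_functions.

(** * Moments of normally distributed random variables *)

Section normal_moments.
Context d (T : measurableType d) (R : realType) (P : probability T R).
Implicit Type X : {mfun T >-> R}.
Local Notation mu := (@lebesgue_measure R).

Lemma ge0_integral_normal_law X (m s : R) (f : R -> \bar R) :
  has_normal_law P X m s ->
  measurable_fun [set: R] f -> (forall x, 0 <= f x)%E ->
  (\int[P]_w f (X w) = \int[mu]_x (f x * (normal_pdf m s x)%:E))%E.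
Proof.
move=> XN mf f0.
have mX : measurable_fun [set: T] (X : T -> measurableTypeR R).
  exact: (@measurable_funPT _ _ _ _ X).
(* Repackaged so that its distribution is a measure on the same measurable type as [mu]. *)
pose X' : {mfun T >-> measurableTypeR R} :=
  HB.pack (X : T -> measurableTypeR R) (isMeasurableFun.Build _ _ _ _ _ mX).
pose nu : {measure set (measurableTypeR R) -> \bar R} := distribution P X'.
rewrite -(@ge0_integral_density _ _ R mu nu (normal_pdf m s))//.
- by rewrite (@ge0_integral_distribution _ _ _ _ R P X').
- exact: measurable_normal_pdf.
- by move=> x; exact: normal_pdf_ge0.
Qed.

Lemma integral_sqr_normal_law X (m s : R) : 0 < s -> has_normal_law P X m s ->
  (\int[P]_w ((X w - m) ^+ 2)%:E = (s ^+ 2)%:E)%E.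
Proof.
move=> s0 XN.
rewrite (ge0_integral_normal_law XN (f := fun x => ((x - m) ^+ 2)%:E))//.
- rewrite -(integral_sqr_normal_pdf m s0).
  by apply: eq_integral => x _; rewrite EFinM.
- by apply/measurable_EFinP/measurable_funX/measurable_funB.
- by move=> x; rewrite lee_fin sqr_ge0.
Qed.

Lemma square_integrable_normal_law X (m s : R) : 0 < s -> has_normal_law P X m s ->
  square_integrable P (fun w => X w - m).
Proof.
move=> s0 XN; split; first exact: measurable_funB.
apply/integrableP; split.
  by apply/measurable_EFinP/measurable_funX/measurable_funB.
rewrite (eq_integral (fun w => ((X w - m) ^+ 2)%:E)); last first.
  by move=> w _; rewrite gee0_abs// lee_fin sqr_ge0.
by rewrite (integral_sqr_normal_law s0 XN)// ltry.
Qed.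

(** The density is even, so [x -> - x] exchanges the integrals of the positive and the negative
    part. *)
Lemma Rintegral_normal_law0 X (s : R) : 0 < s -> has_normal_law P X 0 s ->
  \int[P]_w X w = 0.
Proof.
move=> s0 XN.
have mpos : measurable_fun [set: R] (fun x : R => (Num.max x 0)%:E).
  exact/measurable_EFinP/measurable_maxr.
have mneg : measurable_fun [set: R] (fun x : R => (Num.max (- x) 0)%:E).
  have mN : measurable_fun [set: R] (fun x : R => - x) := @oppr_measurable R _.
  by apply/measurable_EFinP; apply: measurable_maxr.
have mpdf : measurable_fun [set: R] (fun x : R => (normal_pdf 0 s x)%:E).
  by apply/measurable_EFinP; exact: measurable_normal_pdf.
rewrite /Rintegral integralE.
have -> : (\int[P]_w ((fun w => (X w)%:E)^\+) w =
    \int[P]_w (Num.max (X w) 0)%:E)%E.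
  by apply: eq_integral => w _; rewrite funeposE EFin_max.
have -> : (\int[P]_w ((fun w => (X w)%:E)^\-) w =
    \int[P]_w (Num.max (- X w) 0)%:E)%E.
  by apply: eq_integral => w _; rewrite funenegE EFin_max.
rewrite (ge0_integral_normal_law XN (f := fun x => (Num.max x 0)%:E))//; last first.
  by move=> x; rewrite lee_fin le_max lexx orbT.
rewrite (ge0_integral_normal_law XN (f := fun x => (Num.max (- x) 0)%:E))//; last first.
  by move=> x; rewrite lee_fin le_max lexx orbT.
set I := (X in fine (X - _)); set J := (X in fine (_ - X)).
(* Finiteness need not be checked: if both were infinite, [fine] of the difference would again be
   [0]. *)
suff -> : I = J by case: J => [r| |] //=; rewrite subrr.
have pdfN x : normal_pdf 0 s (- x) = normal_pdf 0 s x :> R.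
  by rewrite normal_pdfE ?gt_eqF// /normal_fun !subr0 sqrrN.
rewrite /I /J.
have -> : (\int[mu]_x ((Num.max x 0)%:E * (normal_pdf 0 s x)%:E) =
    \int[mu]_(x in `[0%R, +oo[) ((Num.max x 0)%:E * (normal_pdf 0 s x)%:E))%E.
  rewrite [RHS]integral_mkcond; apply: eq_integral => x _; rewrite patchE.
  case: ifPn => //; rewrite notin_setE/= in_itv/= andbT => /negP; rewrite -ltNge => x0.
  by rewrite max_r ?mul0e// ltW.
have -> : (\int[mu]_x ((Num.max (- x) 0)%:E * (normal_pdf 0 s x)%:E) =
    \int[mu]_(x in `]-oo, 0%R]) ((Num.max (- x) 0)%:E * (normal_pdf 0 s x)%:E))%E.
  rewrite [RHS]integral_mkcond; apply: eq_integral => x _; rewrite patchE.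
  case: ifPn => //; rewrite notin_setE/= in_itv/= => /negP; rewrite -ltNge => x0.
  by rewrite max_r ?mul0e// oppr_le0 ltW.
rewrite ge0_integration_by_substitution0.
- by apply: eq_integral => x _; rewrite pdfN.
- exact: emeasurable_funM.
- by move=> x; rewrite mule_ge0// lee_fin ?normal_pdf_ge0// le_max lexx orbT.
Qed.

End normal_moments.

(** * Orthogonality from independence *)

Section independent_product.
Context d (T : measurableType d) (R : realType) (P : probability T R).
Implicit Types X Y : T -> R.

(** Independence on rectangles identifies the joint law with the product of the marginals, by
    uniqueness of the product measure; in Fubini the inner integral is [x] times the mean of [Y],
    which is [0]. *)
Lemma Rintegral_independent_mul X Y :
  (forall A C, measurable A -> measurable C ->
    P ((X @^-1` A) `&` (Y @^-1` C)) = (P (X @^-1` A) * P (Y @^-1` C))%E) ->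
  square_integrable P X -> square_integrable P Y ->
  \int[P]_w Y w = 0 -> \int[P]_w (X w * Y w) = 0.
Proof.
move=> XY X2 Y2 Y0.
have mXY : measurable_fun [set: T] (fun w => (X w, Y w)).
  exact: measurable_fun_pair X2.1 Y2.1.
pose W : {mfun T >-> (R * R)%type} :=
  HB.pack (fun w => (X w, Y w)) (isMeasurableFun.Build _ _ _ _ _ mXY).
pose f (z : R * R) := (z.1 * z.2)%:E.
have mf : measurable_fun [set: R * R] f.
  by apply/measurable_EFinP/measurable_funM.
pose X' : {mfun T >-> R} := HB.pack X (isMeasurableFun.Build _ _ _ _ _ X2.1).
pose Y' : {mfun T >-> R} := HB.pack Y (isMeasurableFun.Build _ _ _ _ _ Y2.1).
pose m1 := distribution P X'; pose m2 := distribution P Y'.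
have m12 A : measurable A -> (m1 \x m2)%E A = distribution P W A.
  apply: product_measure_unique => A1 A2 mA1 mA2.
  rewrite -XY//.
have fXY : P.-integrable [set: T] (f \o W).
  exact: L2_integrableM.
have fW : (distribution P W).-integrable [set: R * R] f.
  exact: integrable_pushforward.
have f12 : (m1 \x m2)%E.-integrable [set: R * R] f.
  apply/integrableP; split => //; move/integrableP : fW => [_ fW].
  by rewrite (eq_measure_integral (distribution P W))// => A mA _; exact: m12.
rewrite /Rintegral -[X in fine X](@integral_distribution _ _ _ _ _ P W f)//.
rewrite -(eq_measure_integral (distribution P W) (m1 := (m1 \x m2)%E)); last first.
  by move=> A mA _; exact: m12.
rewrite -integral12_prod_meas1// (_ : fubini_F m2 f = cst 0%E) ?integral0//.
apply/funext => x; rewrite /fubini_F /f/=.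
have iY := L2_integrable Y2.
have im2 : m2.-integrable [set: R] EFin by apply: integrable_pushforward => //; exact: Y2.1.
under eq_integral do rewrite EFinM.
rewrite integralZl// (@integral_distribution _ _ _ _ _ P Y')// -[X in (_ * X)%E]fineK.
  by rewrite (_ : fine _ = 0) ?mule0.
exact: integrable_fin_num.
Qed.

End independent_product.

(** * Riemann sums against Brownian motion *)

Section brownian_increments.
Context d (T : measurableType d) (R : realType) (P : probability T R).
Variable B : R -> {RV P >-> R}.
Hypothesis B_brownian : standard_brownian_motion B.
Local Notation L2 := (square_integrable P).
Implicit Types s t : R.

Lemma L2_brownian_increment s t : 0 <= s -> s <= t -> t <= 1 ->
  L2 (fun w => B t w - B s w).
Proof.
move=> s0; rewrite le_eqVlt => /predU1P[->|st] t1.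
  by under eq_fun do rewrite subrr; exact: L2_cst.
have ts0 : 0 < Num.sqrt (t - s) by rewrite sqrtr_gt0 subr_gt0.
have := bm_increment_normal B_brownian s0 st t1.
move=> /(square_integrable_normal_law (X := (B t \- B s)%R) ts0).
by under eq_fun do rewrite subr0.
Qed.

Lemma Rintegral_brownian_increment s t : 0 <= s -> s <= t -> t <= 1 ->
  \int[P]_w (B t w - B s w) = 0.
Proof.
move=> s0; rewrite le_eqVlt => /predU1P[->|st] t1.
  under eq_Rintegral do rewrite subrr.
  by rewrite Rintegral_cst// mul0r.
have ts0 : 0 < Num.sqrt (t - s) by rewrite sqrtr_gt0 subr_gt0.
have := bm_increment_normal B_brownian s0 st t1.
exact: (Rintegral_normal_law0 (X := (B t \- B s)%R) ts0).
Qed.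

Lemma Rintegral_sqr_brownian_increment s t : 0 <= s -> s <= t -> t <= 1 ->
  \int[P]_w ((B t w - B s w) ^+ 2) = t - s.
Proof.
move=> s0; rewrite le_eqVlt => /predU1P[->|st] t1.
  under eq_Rintegral do rewrite subrr expr0n/=.
  by rewrite Rintegral_cst// mul0r subrr.
have ts0 : 0 < Num.sqrt (t - s) by rewrite sqrtr_gt0 subr_gt0.
have := bm_increment_normal B_brownian s0 st t1.
move=> /(integral_sqr_normal_law (X := (B t \- B s)%R) ts0).
rewrite sqr_sqrtr ?subr_ge0 ?(ltW st)// => h.
rewrite /Rintegral (eq_integral (fun w => (((B t \- B s) w - 0) ^+ 2)%:E)) ?h//.
by move=> w _; rewrite subr0.
Qed.

(* Polarisation: both squared increments and the square of their sum are known. *)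
Lemma Rintegral_brownian_increment_adjacent a b c :
  0 <= a -> a <= b -> b <= c -> c <= 1 ->
  \int[P]_w ((B b w - B a w) * (B c w - B b w)) = 0.
Proof.
move=> a0 ab bc c1; have ac := le_trans ab bc.
have b0 := le_trans a0 ab; have b1 := le_trans bc c1.
have := RintegralD_sqr
  (L2_brownian_increment a0 ab b1) (L2_brownian_increment b0 bc c1).
rewrite !Rintegral_sqr_brownian_increment//.
under eq_Rintegral => w _ do rewrite addrC subrKA.
rewrite Rintegral_sqr_brownian_increment// => h; lra.
Qed.

(** The increment over [[c, e]] is the difference of those over [[b, e]] and [[b, c]], and both of
    these intervals are adjacent to [[a, b]]. *)
Lemma Rintegral_brownian_increment_mul a b c e :
  0 <= a -> a <= b -> b <= c -> c <= e -> e <= 1 ->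
  \int[P]_w ((B b w - B a w) * (B e w - B c w)) = 0.
Proof.
move=> a0 ab bc ce e1; have be := le_trans bc ce.
have b0 := le_trans a0 ab; have b1 := le_trans be e1; have c1 := le_trans ce e1.
have ab2 := L2_brownian_increment a0 ab b1.
have := Rintegral_brownian_increment_adjacent a0 ab be e1.
have := Rintegral_brownian_increment_adjacent a0 ab bc c1.
move=> h1 h2; rewrite -[RHS](subrr 0) -{1}h2 -h1 -RintegralB//.
- by apply: eq_Rintegral => w _; ring.
- exact: L2_integrableM ab2 (L2_brownian_increment b0 be e1).
- exact: L2_integrableM ab2 (L2_brownian_increment b0 bc c1).
Qed.

(** This lets the independence of [V] from the whole process be applied to a single increment. *)
Lemma sigma_process_increment (I : set R) s t (A : set R) : I s -> I t ->
  measurable A -> sigma_process I B ((fun w => B t w - B s w) @^-1` A).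
Proof.
move=> Is It mA.
pose G := \bigcup_(t in I) g_sigma_algebra_preimage (B t).
have mB u : I u -> measurable_fun [set: g_sigma_algebraType G] (B u : _ -> R).
  move=> Iu _ C mC; apply: sub_sigma_algebra; exists u => //.
  by exists C.
have := measurable_funB (mB t It) (mB s Is) measurableT mA.
by rewrite setTI.
Qed.

Variables (V : {RV P >-> R}) (mu gamma : R).
Hypothesis gamma_gt0 : 0 < gamma.
Hypothesis V_normal : has_normal_law P V mu gamma.
Hypothesis BV_independent : independent_systems P
  (sigma_process `[0, 1] B) (g_sigma_algebra_preimage V).

Lemma L2_standardized : L2 (fun w => (V w - mu) / gamma).
Proof.
under eq_fun do rewrite mulrC.
exact/L2Z/(square_integrable_normal_law gamma_gt0 V_normal).
Qed.

Lemma Rintegral_sqr_standardized : \int[P]_w (((V w - mu) / gamma) ^+ 2) = 1.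
Proof.
under eq_Rintegral do rewrite expr_div_n mulrC.
have V2 := square_integrable_normal_law gamma_gt0 V_normal.
rewrite RintegralZl//; last exact: V2.2.
rewrite /Rintegral (integral_sqr_normal_law gamma_gt0 V_normal)/=.
by rewrite mulVf// sqrf_eq0 gt_eqF.
Qed.

Lemma Rintegral_standardized_brownian s t : 0 <= s -> s <= t -> t <= 1 ->
  \int[P]_w ((V w - mu) / gamma * (B t w - B s w)) = 0.
Proof.
move=> s0 st t1.
have B2 := L2_brownian_increment s0 st t1.
apply: Rintegral_independent_mul => //.
- move=> A C mA mC; rewrite setIC [RHS]muleC; apply: BV_independent.
    apply: sigma_process_increment => //=; rewrite in_itv/=.
      by rewrite s0 (le_trans st t1).
    by rewrite t1 (le_trans s0 st).
  exists ((fun v => (v - mu) / gamma) @^-1` A); last by rewrite setTI.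
  rewrite -[X in measurable X]setTI.
  have mg : measurable_fun [set: R] (fun v : R => (v - mu) / gamma).
    by apply: measurable_funM => //; exact: measurable_funB.
  exact: mg.
- exact: L2_standardized.
- exact: Rintegral_brownian_increment.
Qed.

End brownian_increments.

(** The index [i = k * j + r] is the [r]-th fine cell inside the [k]-th coarse cell. *)
Lemma big_nat_mul (V : zmodType) (F : nat -> V) n j :
  \sum_(0 <= i < n * j) F i = \sum_(0 <= k < n) \sum_(0 <= r < j) F (k * j + r)%N.
Proof.
elim: n => [|n IHn]; first by rewrite mul0n !big_nil.
rewrite big_nat_recr//= -IHn mulSnr (@big_cat_nat _ _ _ (n * j))//= ?leq_addr//.
congr (_ + _); rewrite -{1}[(n * j)%N]add0n big_addn addKn.
by apply: eq_bigr => i _; rewrite addnC.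
Qed.

(** * The kernel [a] and its bounds *)

Section kernel.
Context {R : realType}.
Variable L : R.
Hypotheses (L_gt0 : 0 < L) (L_lt1 : L < 1).

(** For [L = 1] this would be the kernel [1 / (1 - s)] of the Brownian bridge, singular at time
    [1]. *)
Definition bridge_kernel (s : R) : R := (1 - s * L ^+ 2)^-1.
Local Notation a := bridge_kernel.
Local Notation c := (1 - L ^+ 2)^-1.

Lemma sqrL_lt1 : 0 < L ^+ 2 < 1.
Proof. by rewrite exprn_gt0//= expr_lt1// ltW. Qed.

Lemma bridge_denominator_gt0 s : 0 <= s <= 1 -> 0 < 1 - s * L ^+ 2.
Proof. move=> /andP[s0 s1]; have /andP[] := sqrL_lt1; set l := L ^+ 2 => *; nra. Qed.

Lemma bridge_kernel_ge1 s : 0 <= s <= 1 -> 1 <= a s.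
Proof.
move=> /[dup] s01 /andP[s0 s1]; rewrite invf_ge1 ?bridge_denominator_gt0//.
by rewrite gerBl mulr_ge0// sqr_ge0.
Qed.

Lemma bridge_kernel_le s : 0 <= s <= 1 -> a s <= c.
Proof.
move=> /[dup] s01 /andP[s0 s1]; have /andP[l0 l1] := sqrL_lt1.
by rewrite lef_pV2 ?posrE ?bridge_denominator_gt0 ?subr_gt0// lerB// ler_piMl// ltW.
Qed.

(** Behind both the Lipschitz bound and the telescoping of the second moments. *)
Lemma bridge_kernelB r s : 0 <= r <= 1 -> 0 <= s <= 1 ->
  a s - a r = L ^+ 2 * (s - r) * (a r * a s).
Proof.
move=> /bridge_denominator_gt0 r0 /bridge_denominator_gt0 s0; rewrite /a.
by field; rewrite !gt_eqF.
Qed.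

Lemma bridge_kernel_lipschitz r s : 0 <= r <= 1 -> 0 <= s <= 1 ->
  `|a s - a r| <= c ^+ 2 * `|s - r|.
Proof.
move=> r01 s01; rewrite bridge_kernelB//.
have r1 := bridge_kernel_ge1 r01; have s1 := bridge_kernel_ge1 s01.
have rc := bridge_kernel_le r01; have sc := bridge_kernel_le s01.
have /andP[l0 l1] := sqrL_lt1.
have ar0 := le_trans ler01 r1; have as0 := le_trans ler01 s1.
rewrite [`|_ * (a r * a s)|]normrM [`|L ^+ 2 * _|]normrM [`|a r * _|]normrM 
  (ger0_norm ar0) (ger0_norm as0) (ger0_norm (ltW l0)) mulrC.
have cc : a r * a s <= c ^+ 2 by rewrite expr2; exact: ler_pM.
rewrite mulrA ler_wpM2r// -[leRHS]mulr1.
by apply: ler_pM => //; [exact: mulr_ge0|exact: ltW|exact: ltW].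
Qed.

End kernel.

(** * Uniform grids and their refinements *)

Section grid.
Context {R : realType}.
Variable t : R.
Hypothesis t01 : 0 <= t <= 1.

Definition grid n k : R := t * (k%:R / n%:R).

Lemma grid0 n : grid n 0 = 0.
Proof. by rewrite /grid mul0r mulr0. Qed.

Lemma gridnn n : (0 < n)%N -> grid n n = t.
Proof. by move=> n0; rewrite /grid divff ?mulr1// pnatr_eq0 -lt0n. Qed.

Lemma gridS n k : grid n k.+1 - grid n k = t / n%:R.
Proof. by rewrite /grid -mulrBr -mulrBl -natrB// subSnn mul1r. Qed.

Lemma grid_le n j k : (j <= k)%N -> grid n j <= grid n k.
Proof.
case/andP: t01 => t0 _ jk.
by rewrite ler_wpM2l// ler_wpM2r ?invr_ge0 ?ler0n// ler_nat.
Qed.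

Lemma grid_ge0 n k : 0 <= grid n k.
Proof. by rewrite -(grid0 n) grid_le. Qed.

Lemma grid_le1 n k : (0 < n)%N -> (k <= n)%N -> grid n k <= 1.
Proof.
case/andP: t01 => _ t1 n0 kn; apply: le_trans t1.
by rewrite -[leRHS](@gridnn n)// grid_le.
Qed.

Lemma grid01 n k : (0 < n)%N -> (k <= n)%N -> 0 <= grid n k <= 1.
Proof. by move=> n0 kn; rewrite grid_ge0 grid_le1. Qed.

(** Coarse nodes remain nodes when the number of cells is multiplied, which is why only multiples of
    [n] serve as refinements. *)
Lemma grid_mul n j k : (0 < j)%N -> grid (n * j) (k * j) = grid n k.
Proof.
by move=> j0; rewrite /grid !natrM -mulf_div divff ?mulr1// pnatr_eq0 -lt0n.
Qed.

Lemma grid_divn_dist n j i : (0 < n)%N -> (0 < j)%N ->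
  `|grid n (i %/ j) - grid (n * j) i| <= n%:R^-1.
Proof.
move=> n0 j0; case/andP: t01 => t0 t1.
rewrite -(@grid_mul n j)// distrC ger0_norm; last first.
  by rewrite subr_ge0 grid_le// leq_trunc_div.
have : (i <= (i %/ j) * j + j)%N.
  by rewrite {1}(divn_eq i j) leq_add2l ltnW// ltn_pmod.
move=> /(grid_le (n * j)) h; apply: (le_trans (lerB h (lexx _))).
rewrite /grid -mulrBr -mulrBl -natrB ?leq_addr// addKn natrM.
have nR : n%:R != 0 :> R by rewrite pnatr_eq0 -lt0n.
have jR : j%:R != 0 :> R by rewrite pnatr_eq0 -lt0n.
rewrite (_ : t * _ = t / n%:R); last by field; rewrite nR.
by rewrite ler_piMl// invr_ge0.
Qed.

End grid.

(** * Second moments of the Riemann sums *)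

Section wiener_sums.
Context d (T : measurableType d) (R : realType) (P : probability T R).
Variable B : R -> {RV P >-> R}.
Hypothesis B_brownian : standard_brownian_motion B.
Variables (t L : R).
Hypotheses (t01 : 0 <= t <= 1) (L_gt0 : 0 < L) (L_lt1 : L < 1).
Local Notation L2 := (square_integrable P).
Local Notation a := (bridge_kernel L).
Local Notation c := (1 - L ^+ 2)^-1.

Definition grid_increment n k w : R := B (grid t n k.+1) w - B (grid t n k) w.

Lemma L2_grid_increment n k : (0 < n)%N -> (k < n)%N -> L2 (grid_increment n k).
Proof.
move=> n0 kn; apply: L2_brownian_increment => //.
- exact: grid_ge0.
- by apply: grid_le => //; exact: leqnSn.
- exact: grid_le1.
Qed.

Lemma L2_grid_sum n (f : nat -> R) : (0 < n)%N ->
  L2 (fun w => \sum_(0 <= k < n) f k * grid_increment n k w).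
Proof. by move=> n0; apply: L2_sum => k kn; exact: L2_grid_increment. Qed.

Lemma Rintegral_sqr_grid_sum n (f : nat -> R) : (0 < n)%N ->
  \int[P]_w ((\sum_(0 <= k < n) f k * grid_increment n k w) ^+ 2) =
  \sum_(0 <= k < n) f k ^+ 2 * (t / n%:R).
Proof.
move=> n0; apply: Rintegral_sqr_orthogonal_sum.
- by move=> k kn; exact: L2_grid_increment.
- move=> j k /andP[jk kn]; apply: Rintegral_brownian_increment_mul => //.
  + exact: grid_ge0.
  + by apply: grid_le => //; exact: leqnSn.
  + exact: grid_le.
  + by apply: grid_le => //; exact: leqnSn.
  + exact: grid_le1.
- move=> k kn; rewrite Rintegral_sqr_brownian_increment// ?gridS//.
  + exact: grid_ge0.
  + by apply: grid_le => //; exact: leqnSn.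
  + exact: grid_le1.
Qed.

Definition wiener_sum n w : R :=
  \sum_(0 <= k < n) a (grid t n k) * grid_increment n k w.

(** Fine increments telescope within a coarse cell, where the kernel is frozen at the left coarse
    node. A coarse and a fine sum thus become sums over the same orthogonal increments. *)
Lemma wiener_sum_refine n j w : (0 < j)%N -> wiener_sum n w =
  \sum_(0 <= i < n * j) a (grid t n (i %/ j)) * grid_increment (n * j) i w.
Proof.
move=> j0; rewrite big_nat_mul; apply: eq_bigr => k _.
transitivity (\sum_(0 <= r < j) a (grid t n k) * grid_increment (n * j) (k * j + r) w).
  rewrite -mulr_sumr; congr (_ * _); rewrite /grid_increment.
  under eq_bigr do rewrite -addnS.
  rewrite (telescope_sumr (fun r => B (grid t (n * j) (k * j + r)) w))//.
  by rewrite addn0 -mulSnr !grid_mul.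
by rewrite !big_nat; apply: eq_bigr => r /andP[_ rj]; rewrite divnMDl// divn_small// addn0.
Qed.

Lemma L2_wiener_sum n : (0 < n)%N -> L2 (wiener_sum n).
Proof. exact: L2_grid_sum. Qed.

(** The two kernels differ by at most the Lipschitz constant [c ^+ 2] times the mesh, and the cell
    lengths add up to [t <= 1]. *)
Lemma Rintegral_sqr_wiener_sumB n j : (0 < n)%N -> (0 < j)%N ->
  \int[P]_w ((wiener_sum n w - wiener_sum (n * j) w) ^+ 2) <= (c ^+ 2 / n%:R) ^+ 2.
Proof.
move=> n0 j0; have nj0 : (0 < n * j)%N by rewrite muln_gt0 n0.
pose f i := a (grid t n (i %/ j)) - a (grid t (n * j) i).
rewrite (_ : \int[P]_w _ = \sum_(0 <= i < n * j) f i ^+ 2 * (t / (n * j)%:R)); last first.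
  rewrite -Rintegral_sqr_grid_sum//; apply: eq_Rintegral => w _.
  rewrite (@wiener_sum_refine n j)// /wiener_sum -sumrB.
  by congr (_ ^+ 2); apply: eq_bigr => i _; rewrite mulrBl.
have njR : 0 < (n * j)%:R :> R by rewrite ltr0n.
have /andP[t0 t1] := t01.
have h i : (0 <= i < n * j)%N ->
    f i ^+ 2 * (t / (n * j)%:R) <= (c ^+ 2 / n%:R) ^+ 2 * (n * j)%:R^-1.
  move=> /andP[_ inj]; apply: ler_pM; rewrite ?sqr_ge0 ?divr_ge0 ?ler0n//; last first.
    by rewrite ler_piMl// invr_ge0 ltW.
  have ij01 : 0 <= grid t n (i %/ j) <= 1.
    by apply: grid01 => //; rewrite ltnW// ltn_divLR.
  have i01 : 0 <= grid t (n * j) i <= 1 by apply: grid01 => //; exact: ltnW.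
  have := bridge_kernel_lipschitz L_gt0 L_lt1 i01 ij01.
  have := grid_divn_dist t01 i n0 j0.
  rewrite -/(f i) => hd hl; rewrite -[leLHS]real_normK ?num_real//.
  have cn0 : 0 <= c ^+ 2 / n%:R by rewrite divr_ge0 ?sqr_ge0 ?ler0n.
  rewrite ler_pXn2r ?nnegrE//.
  by apply: (le_trans hl); rewrite ler_wpM2l ?sqr_ge0.
apply: (@le_trans _ _
  (\sum_(0 <= i < n * j) (c ^+ 2 / n%:R) ^+ 2 * (n * j)%:R^-1)).
  by rewrite [leLHS]big_nat [leRHS]big_nat; exact: ler_sum.
rewrite sumr_const_nat subn0 -[X in X <= _]mulr_natr -mulrA mulVf ?mulr1//.
by rewrite gt_eqF.
Qed.

(* [L ^+ 2 * (t / n) * (a t_k * a t_k.+1) = a t_k.+1 - a t_k] makes the sum with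
   [a t_k * a t_k.+1] in place of [a t_k ^+ 2] telescope. *)
Lemma Rintegral_sqr_wiener_sum_bounds n : (0 < n)%N ->
  a t - 1 - c ^+ 2 / n%:R <= L ^+ 2 * \int[P]_w (wiener_sum n w ^+ 2) <= a t - 1.
Proof.
move=> n0; rewrite Rintegral_sqr_grid_sum//.
have nR : 0 < n%:R :> R by rewrite ltr0n.
have /andP[t0 t1] := t01.
have /andP[l0 l1] := sqrL_lt1 L_gt0 L_lt1.
pose b k := a (grid t n k).
have b01 k : (k <= n)%N -> 1 <= b k /\ b k <= c.
  move=> kn; have g01 := grid01 t01 n0 kn.
  by split; [exact: bridge_kernel_ge1|exact: bridge_kernel_le].
have bS k : (k < n)%N -> b k.+1 - b k = L ^+ 2 * (t / n%:R) * (b k * b k.+1).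
  move=> kn; rewrite -(gridS t n k) bridge_kernelB//.
    by apply: grid01 => //; exact: ltnW.
  exact: grid01.
have b0 : b 0 = 1 by rewrite /b grid0 /bridge_kernel mul0r subr0 invr1.
have bn : b n = a t by rewrite /b gridnn.
have tele : \sum_(0 <= k < n) (b k.+1 - b k) = a t - 1.
  by rewrite telescope_sumr// b0 bn.
have ln0 : 0 <= L ^+ 2 * (t / n%:R) by rewrite mulr_ge0 ?(ltW l0)// divr_ge0// ltW.
have bS0 k : (k < n)%N -> 0 <= b k.+1 - b k.
  move=> kn; rewrite bS//; have [b1 _] := b01 k (ltnW kn); have [b2 _] := b01 k.+1 kn.
  by rewrite mulr_ge0// mulr_ge0// (le_trans ler01).
have -> : L ^+ 2 * \sum_(0 <= k < n) b k ^+ 2 * (t / n%:R) =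
    \sum_(0 <= k < n) L ^+ 2 * (t / n%:R) * b k ^+ 2.
  by rewrite mulr_sumr; apply: eq_bigr => k _; rewrite mulrCA mulrC.
apply/andP; split; last first.
  rewrite -tele [leLHS]big_nat [leRHS]big_nat; apply: ler_sum => k /andP[_ kn].
  have [b1 _] := b01 k (ltnW kn); have := bS0 k kn; rewrite subr_ge0 => bb.
  by rewrite bS// ler_wpM2l// expr2 ler_wpM2l// (le_trans ler01).
have at1 : a t - 1 <= c.
  by have [_] := b01 n (leqnn _); rewrite bn => h; lra.
apply: (@le_trans _ _ (a t - 1 - (a t - 1) * (c / n%:R))).
  rewrite lerB// expr2 -mulrA ler_wpM2r// divr_ge0 ?ler0n// invr_ge0; lra.
(* Termwise: passing from [b k * b k.+1] to [b k ^+ 2] costs [b k.+1 - b k] times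
   [L^2 (t / n) b k <= c / n], and these costs telescope as well. *)
rewrite -{1 2}tele mulr_suml -sumrB [leLHS]big_nat [leRHS]big_nat.
apply: ler_sum => k /andP[_ kn].
have [b1 b1c] := b01 k (ltnW kn); have [b2 _] := b01 k.+1 kn.
rewrite [X in X - _]bS//.
have -> : L ^+ 2 * (t / n%:R) * (b k * b k.+1) =
  L ^+ 2 * (t / n%:R) * b k ^+ 2 + (b k.+1 - b k) * (L ^+ 2 * (t / n%:R) * b k) by ring.
rewrite -addrA gerDl subr_le0 ler_wpM2l ?bS0//.
rewrite mulrC; apply: ler_pM => //; first exact: le_trans b1.
rewrite mulrA ler_piMl ?invr_ge0 ?ler0n// -[leRHS]mulr1.
by apply: ler_pM => //; exact: ltW.
Qed.

End wiener_sums.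

(** * Paths of the equilibrium demand *)

(** Heine-Cantor, from the near-covering form of compactness with the radius [r] tending to [0] as
    parameter. *)
Lemma segment_uniformly_continuous (R : realType) (f : R -> R) (a b e : R) :
  {within `[a, b], continuous f} -> 0 < e ->
  exists2 r : R, 0 < r & forall x y, x \in `[a, b] -> y \in `[a, b] ->
    `|x - y| < r -> `|f x - f y| < e.
Proof.
move=> /subspace_continuousP cf e0; have e20 : 0 < e / 2 by rewrite divr_gt0.
have /compact_near_coveringP := @segment_compact R a b.
move=> /(_ _ (0 : R)^'+ (fun r x => x \in `[a, b] -> forall y, y \in `[a, b] ->
   `|x - y| < r -> `|f x - f y| < e) _) h.
have {h} : \forall r \near (0 : R)^'+, forall x, `[a, b]%classic x ->
    x \in `[a, b] -> forall y, y \in `[a, b] -> `|x - y| < r -> `|f x - f y| < e.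
  apply: h => x0 x0ab.
  have := cf x0 x0ab => /cvgrPdist_lt/(_ (e / 2) e20).
  move=> /nbhs_ballP[r /= r0 fr].
  exists (ball x0 (r / 2), [set u | 0 < u < r / 2]) => /=.
    split; first by apply: nbhsx_ballx; rewrite divr_gt0.
    by near=> u; apply/andP; split; near: u;
      [exact: nbhs_right_gt|apply: nbhs_right_lt; rewrite divr_gt0].
  move=> [x u] /= [x0x /andP[u0 ur]] xab y yab xyu.
  have fx : `|f x0 - f x| < e / 2.
    apply: fr => //; rewrite /ball/=; apply: lt_trans x0x _; lra.
  have fy : `|f x0 - f y| < e / 2.
    apply: fr => //; rewrite /ball/= -(subrKA x).
    apply: le_lt_trans (ler_normD _ _) _; move: x0x; rewrite /ball/= => x0x; lra.
  have -> : f x - f y = (f x0 - f y) - (f x0 - f x) by ring.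
  apply: le_lt_trans (ler_normB _ _) _; lra.
move=> [r /= r0 hr]; exists (r / 2); first by rewrite divr_gt0.
move=> x y xab yab xy; apply: (hr (r / 2)) => //.
- by rewrite /= sub0r normrN gtr0_norm ?divr_gt0// ltr_pdivrMr// ltr_pMr// ltr1n.
- by rewrite divr_gt0.
Unshelve. all: by end_near. Qed.

Section demand_path.
Context {R : realType}.
Variables (mu gamma sigma kappa v : R) (b y : R -> R).
Implicit Types r s t e : R.
Hypotheses (sigma_gt0 : 0 < sigma) (kappa_gt0 : 0 < kappa).
Hypothesis y0 : y 0 = 0.
Hypothesis cy : {within `[0, 1], continuous y}.
Hypothesis yE : forall t, 0 <= t -> t <= 1 ->
  y t = sigma * b t + \int[lebesgue_measure]_(s in `[0, t])
          trading_rate mu gamma sigma kappa v s (y s).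
Local Notation L := (Lambda kappa).
Local Notation a := (bridge_kernel L).
Local Notation c := (1 - L ^+ 2)^-1.
Local Notation leb := (@lebesgue_measure R).

(** The process [M] at one outcome: [v], [b] and [y] stand for the value of [V] and the paths of [B]
    and [Y], so this section is deterministic. *)
Definition scaled_rate (t : R) : R := a t * ((v - mu) / gamma - L * y t / sigma).
Local Notation M := scaled_rate.

Lemma trading_rateE t :
  trading_rate mu gamma sigma kappa v t (y t) = L * sigma * M t.
Proof. by rewrite /trading_rate /M /bridge_kernel [a t * _]mulrC. Qed.

Lemma scaled_rate0 : M 0 = (v - mu) / gamma.
Proof. by rewrite /M /bridge_kernel y0 mul0r subr0 invr1 mul1r mulr0 mul0r subr0. Qed.

Let L_gt0 : 0 < L := Lambda_gt0 kappa.
Let L_lt1 : L < 1 := Lambda_lt1 kappa_gt0.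

Lemma continuous_scaled_rate : {within `[0, 1], continuous M}.
Proof.
apply/subspace_continuousP => x /= /[dup] x01; rewrite in_itv/= => x01'.
have /subspace_continuousP/(_ x x01) cyx := cy.
have ca : a s @[s --> within `[0, 1]%classic (nbhs x)] --> a x.
  apply: cvg_within_filter; apply: cvgV; first by rewrite gt_eqF// bridge_denominator_gt0.
  by apply: cvgB; [exact: cvg_cst|apply: cvgMl; exact: cvg_id].
apply: cvgM => //; apply: cvgB; first exact: cvg_cst.
by apply: cvgMl; apply: cvgMr; exact: cyx.
Qed.

Lemma integrable_scaled_rate : leb.-integrable `[0, 1] (EFin \o M).
Proof.
apply: continuous_compact_integrable; first exact: segment_compact.
exact: continuous_scaled_rate.
Qed.

Lemma demand_increment r s : 0 <= r -> r <= s -> s <= 1 ->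
  y s - y r = sigma * (b s - b r) + L * sigma * \int[leb]_(u in `]r, s]) M u.
Proof.
move=> r0 rs s1.
have iM (u : R) : u <= 1 -> leb.-integrable `[0, u] (EFin \o M).
  move=> u1; apply: integrableS integrable_scaled_rate => //.
  by apply: subset_itvl; rewrite bnd_simp.
have intE u : u <= 1 -> \int[leb]_(s in `[0, u]) trading_rate mu gamma sigma kappa v s (y s)
    = L * sigma * \int[leb]_(s in `[0, u]) M s.
  move=> u1; rewrite -RintegralZl//; last exact: iM.
  by apply: eq_Rintegral => x _; rewrite trading_rateE.
rewrite -(@Rintegral_itvB _ M (BLeft 0) (BRight s) r) ?bnd_simp//; last exact: iM.
have s0 := le_trans r0 rs; have r1 := le_trans rs s1.
rewrite (yE s0 s1) (yE r0 r1) !intE//; ring.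
Qed.

(** The rectangle has its height at the right end because [(s - r) * M s] is what the increment of
    [a] produces in the next lemma. *)
Lemma Rintegral_close r s e : 0 <= r -> r <= s -> s <= 1 ->
  (forall u, r <= u <= s -> `|M s - M u| <= e) ->
  `|(s - r) * M s - \int[leb]_(u in `]r, s]) M u| <= e * (s - r).
Proof.
move=> r0 rs s1 Me.
have leb_rs : fine (leb `]r, s]) = s - r.
  rewrite lebesgue_measure_itv/= lte_fin; case: ifPn => //.
  by rewrite -leNgt => sr; rewrite (@le_anti _ _ r s) ?subrr// rs sr.
have iM : leb.-integrable `]r, s] (EFin \o M).
  apply: integrableS integrable_scaled_rate => //.
  by apply: subset_itv; rewrite bnd_simp.
have icst k : leb.-integrable `]r, s] (EFin \o cst k).
  have : leb.-integrable `[r, s] (EFin \o cst k).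
    apply: continuous_compact_integrable; first exact: segment_compact.
    by apply: continuous_subspaceT => x; exact: cvg_cst.
  by apply: integrableS => //; apply: subset_itv; rewrite bnd_simp.
have -> : (s - r) * M s = \int[leb]_(u in `]r, s]) cst (M s) u.
  by rewrite Rintegral_cst// leb_rs mulrC.
have iB : leb.-integrable `]r, s] (EFin \o (fun u => M s - M u)).
  have := integrableB _ (icst (M s)) iM.
  by move=> /(_ (measurable_itv _)); apply: eq_integrable => // u _ /=; rewrite EFinB.
rewrite -RintegralB//; apply: (le_trans (le_normr_Rintegral _ iB)) => //.
rewrite -leb_rs -Rintegral_cst//.
apply: le_Rintegral => //; [exact: integrable_norm|exact: icst|].
by move=> u /=; rewrite in_itv/= => /andP[ru us]; apply: Me; rewrite us (ltW ru).
Qed.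

(* Discrete form of [dM = - L a dB]; the drift terms cancel up to the oscillation
   of [M]. *)
Lemma scaled_rate_increment r s e : 0 <= r -> r <= s -> s <= 1 ->
  (forall u, r <= u <= s -> `|M s - M u| <= e) ->
  `|M s - M r + L * (a r * (b s - b r))| <= c * (e * (s - r)).
Proof.
move=> r0 rs s1 Me; have s0 := le_trans r0 rs; have r1 := le_trans rs s1.
have r01 : 0 <= r <= 1 by rewrite r0. have s01 : 0 <= s <= 1 by rewrite s0.
have [r_gt0 s_gt0] := (bridge_denominator_gt0 L_gt0 L_lt1 r01,
  bridge_denominator_gt0 L_gt0 L_lt1 s01).
(* By definition of [M], [(1 - r L^2) (M s - M r) = L^2 (s - r) M s - L (y s - y r) / sigma].
   Inserting the integrated equation for [y s - y r] and multiplying by [a r] gives the identity. *)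
have -> : M s - M r + L * (a r * (b s - b r)) =
    L ^+ 2 * a r * ((s - r) * M s - \int[leb]_(u in `]r, s]) M u).
  have : b s - b r = (y s - y r) / sigma - L * \int[leb]_(u in `]r, s]) M u.
    by rewrite (@demand_increment r s)//; field; rewrite gt_eqF.
  move=> ->; rewrite /M; set I := \int[leb]_(u in _) _; set z := (v - mu) / gamma; rewrite /a.
  by field; rewrite (gt_eqF sigma_gt0) (gt_eqF s_gt0) (gt_eqF r_gt0).
have ar1 := bridge_kernel_ge1 L_gt0 L_lt1 r01.
have arc := bridge_kernel_le L_gt0 L_lt1 r01.
have /andP[l0 l1] := sqrL_lt1 L_gt0 L_lt1.
have ar0 := le_trans ler01 ar1.
rewrite [leLHS]normrM (ger0_norm (mulr_ge0 (ltW l0) ar0)).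
apply: ler_pM => //; first exact: mulr_ge0 (ltW l0) ar0.
- by rewrite -[leRHS]mul1r; apply: ler_pM => //; exact: ltW.
- exact: Rintegral_close.
Qed.

(** The increments of [M] telescope, and the errors [c * (e * (t / n))] of the cells add up to at
    most [c * e]. *)
Lemma scaled_rate_riemann_sum t n e : 0 <= t <= 1 -> (0 < n)%N ->
  (forall x z, x \in `[0, 1] -> z \in `[0, 1] -> `|x - z| <= n%:R^-1 ->
    `|M x - M z| <= e) ->
  `|M t - ((v - mu) / gamma - L * \sum_(0 <= k < n)
     a (grid t n k) * (b (grid t n k.+1) - b (grid t n k)))| <= c * e.
Proof.
move=> /[dup] t01 /andP[t0 t1] n0 Me.
have nR : 0 < n%:R :> R by rewrite ltr0n.
have -> : M t - ((v - mu) / gamma - L * \sum_(0 <= k < n)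
     a (grid t n k) * (b (grid t n k.+1) - b (grid t n k))) =
   \sum_(0 <= k < n) (M (grid t n k.+1) - M (grid t n k) +
     L * (a (grid t n k) * (b (grid t n k.+1) - b (grid t n k)))).
  rewrite big_split/= telescope_sumr// -mulr_sumr gridnn// grid0 scaled_rate0.
  by rewrite opprB addrCA addrC.
apply: le_trans (ler_norm_sum _ _ _) _.
apply: (@le_trans _ _ (\sum_(0 <= k < n) c * (e * (t / n%:R)))); last first.
  have e0 : 0 <= e.
    apply: le_trans (Me 0 0 _ _ _); rewrite ?in_itv/= ?lexx ?ler01//.
    by rewrite subrr normr0 invr_ge0 ltW.
  have /andP[l0 l1] := sqrL_lt1 L_gt0 L_lt1.
  rewrite sumr_const_nat subn0 -[leLHS]mulr_natr -mulrA.
  rewrite ler_wpM2l ?invr_ge0 ?subr_ge0 ?(ltW l1)//.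
  by rewrite -mulrA ler_piMr// divfK ?gt_eqF.
rewrite [leLHS]big_nat [leRHS]big_nat; apply: ler_sum => k /andP[_ kn].
rewrite -(gridS t n k); apply: scaled_rate_increment.
- exact: grid_ge0.
- by apply: grid_le => //; exact: leqnSn.
- exact: grid_le1.
- move=> u /andP[ku uk].
  have k0 := grid_ge0 t01 n k; have k1 := grid_le1 t01 n0 kn.
  apply: Me; rewrite ?in_itv/=.
  + by rewrite k1 andbT grid_ge0.
  + by rewrite (le_trans k0 ku) (le_trans uk k1).
  + rewrite ger0_norm ?subr_ge0//; apply: (le_trans (lerB (lexx _) ku)).
    by rewrite gridS ler_piMl// invr_ge0 ltW.
Qed.

Lemma cvg_scaled_rate_riemann_sum t : 0 <= t <= 1 ->
  (v - mu) / gamma - L * \sum_(0 <= k < n)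
    a (grid t n k) * (b (grid t n k.+1) - b (grid t n k)) @[n --> \oo] --> M t.
Proof.
move=> t01; apply/cvgrPdist_le => e e0.
have /andP[l0 l1] := sqrL_lt1 L_gt0 L_lt1.
have c0 : 0 < c by rewrite invr_gt0 subr_gt0.
have [r r0 Mr] := @segment_uniformly_continuous R M 0 1 _ continuous_scaled_rate
  (divr_gt0 e0 c0).
near=> n.
have n0 : (0 < n)%N by near: n; exact: nbhs_infty_gt.
rewrite -[leRHS](divfK (lt0r_neq0 c0)) [leRHS]mulrC.
apply: scaled_rate_riemann_sum => // x z x01 z01 xz.
apply: ltW; apply: Mr => //; apply: le_lt_trans xz _.
rewrite invf_plt ?posrE ?ltr0n//.
by near: n; exact: nbhs_infty_gtr.
Unshelve. all: by end_near. Qed.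

End demand_path.

(** * Expected penalty *)

(* The measure need not be complete, so a function almost everywhere equal to a measurable
   one may fail to be measurable: nothing is assumed on the functions [g]. *)
Section ae_comparison.
Context d (T : measurableType d) (R : realType).
Variable mu : {measure set T -> \bar R}.
Local Open Scope ereal_scope.
Implicit Types f g : T -> \bar R.
Import HBNNSimple.

(** The integral of a nonnegative function is a supremum over the simple functions below it, which
    is monotone without measurability. *)
Lemma ge0_le_integralT f g : (forall x, 0 <= f x) -> (forall x, f x <= g x) ->
  \int[mu]_x f x <= \int[mu]_x g x.
Proof.
move=> f0 fg; rewrite !ge0_integralTE//; last by move=> x; exact: le_trans (fg x).
apply: ereal_sup_le => _ [h /= hf <-].
exists h => // x; exact: le_trans (hf x) (fg x).
Qed.

Lemma ge0_ae_le_integral_measurable_left f g :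
  measurable_fun [set: T] f -> (forall x, 0 <= f x) -> (forall x, 0 <= g x) ->
  {ae mu, forall x, f x <= g x} -> \int[mu]_x f x <= \int[mu]_x g x.
Proof.
move=> mf f0 g0 [N [mN N0 fgN]].
rewrite (@ge0_negligible_integral _ _ _ _ setT N f)// integral_mkcond.
apply: ge0_le_integralT => x; rewrite patchE; case: ifPn => //.
by rewrite inE /= => -[_ Nx]; apply: contrapT => fg; apply: Nx; exact: fgN.
Qed.

Lemma ge0_ae_le_integral_measurable_right f g :
  measurable_fun [set: T] f -> (forall x, 0 <= f x) -> (forall x, 0 <= g x) ->
  {ae mu, forall x, g x <= f x} -> \int[mu]_x g x <= \int[mu]_x f x.
Proof.
move=> mf f0 g0 [N [mN N0 fgN]].
(* Infinite on the exceptional null set: [h] is measurable, dominates [g] everywhere and has the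
   integral of [f]. *)
pose h x := if x \in N then +oo else f x.
have mh : measurable_fun [set: T] h.
  apply: measurable_fun_ifT => //; apply: (measurable_fun_bool true).
  rewrite setTI (_ : _ @^-1` _ = N)//; apply/seteqP.
  by split => x /=; [exact: set_mem|exact: mem_set].
have h0 x : 0 <= h x by rewrite /h; case: ifPn.
apply: (@le_trans _ _ (\int[mu]_x h x)).
  apply: ge0_le_integralT => // x; rewrite /h; case: ifPn => [_|]; first exact: leey.
  rewrite notin_setE => Nx; apply: contrapT => fg; apply: Nx; exact: fgN.
rewrite (@ge0_negligible_integral _ _ _ _ setT N h)// integral_mkcond.
apply: ge0_le_integralT => x; rewrite patchE; case: ifPn => //.
by rewrite inE /= => -[_ Nx]; rewrite /h memNset.
Qed.

Lemma ge0_ae_eq_integral_measurable f g :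
  measurable_fun [set: T] f -> (forall x, 0 <= f x) -> (forall x, 0 <= g x) ->
  {ae mu, forall x, g x = f x} -> \int[mu]_x g x = \int[mu]_x f x.
Proof.
move=> mf f0 g0 gf; apply/eqP; rewrite eq_le; apply/andP; split.
  apply: ge0_ae_le_integral_measurable_right => //.
  by apply: filterS gf => x ->.
apply: ge0_ae_le_integral_measurable_left => //.
by apply: filterS gf => x ->.
Qed.

Lemma limn_einf_le (u : (\bar R)^nat) (l : \bar R) :
  (forall n, u n <= l) -> limn_einf u <= l.
Proof.
move=> ul; rewrite limn_einf_lim; apply: lime_le; first exact: is_cvg_einfs.
apply: nearW => n; apply: le_trans (ul n); apply: ereal_inf_lbound.
by exists n => /=.
Qed.

End ae_comparison.

Lemma le_div_nat_eq0 (R : realType) (x K : R) :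
  (forall n, (0 < n)%N -> `|x| <= K / n%:R) -> x = 0.
Proof.
move=> xK; apply/eqP; rewrite -normr_eq0 eq_le normr_ge0 andbT leNgt.
apply/negP => x0.
have := archi_boundP (divr_ge0 (normr_ge0 K) (ltW x0)); set n := Num.Def.archi_bound _.
rewrite ltr_pdivrMr// => Kn; have := xK n.+1 isT; rewrite ler_pdivlMr ?ltr0Sn//.
apply/negP; rewrite -ltNge; apply: (le_lt_trans (ler_norm K)); apply: (lt_le_trans Kn).
by rewrite mulrC ler_wpM2l ?(ltW x0)// ler_nat.
Qed.

(** * Second moment of an almost sure limit *)

Section square_mean_limit.
Context d (T : measurableType d) (R : realType) (P : probability T R).
Local Notation L2 := (square_integrable P).

(** Young's inequality with weight [n], from the nonnegative second moment of [X + s n D] for the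
    signs [s = 1] and [s = -1]. When the second moment of [D] is [O(1/n^2)], both terms on the right
    are [O(1/n)]. *)
Lemma Rintegral_mul_bound (X D : T -> R) n : (0 < n)%N -> L2 X -> L2 D ->
  `|2 * \int[P]_w (X w * D w)| <=
    (\int[P]_w (X w ^+ 2)) / n%:R + n%:R * \int[P]_w (D w ^+ 2).
Proof.
move=> n0 X2 D2; have nR : 0 < n%:R :> R by rewrite ltr0n.
have h (s : R) : s ^+ 2 = 1 ->
    0 <= (\int[P]_w (X w ^+ 2)) / n%:R + n%:R * \int[P]_w (D w ^+ 2) +
         s * (2 * \int[P]_w (X w * D w)).
  move=> s2.
  have := RintegralD_sqr X2 (L2Z (s * n%:R) D2).
  have -> : \int[P]_w (X w * (s * n%:R * D w)) = s * n%:R * \int[P]_w (X w * D w).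
    rewrite -RintegralZl//; last exact: L2_integrableM X2 D2.
    by apply: eq_Rintegral => w _; rewrite mulrCA.
  have -> : \int[P]_w ((s * n%:R * D w) ^+ 2) = n%:R ^+ 2 * \int[P]_w (D w ^+ 2).
    rewrite -RintegralZl//; last exact: D2.2.
    by apply: eq_Rintegral => w _; rewrite !exprMn s2 mul1r.
  have : 0 <= \int[P]_w ((X w + s * n%:R * D w) ^+ 2).
    by apply: Rintegral_ge0 => w _; exact: sqr_ge0.
  move=> + E; rewrite E => F.
  rewrite -(pmulr_rge0 _ nR); congr (0 <= _) : F; field; by rewrite gt_eqF.
have N1 : (-1 : R) ^+ 2 = 1 by rewrite sqrrN expr1n.
have := h 1 (expr1n _ _); have := h (-1) N1.
by rewrite mul1r mulN1r ler_norml; lra.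
Qed.

(* Fatou's lemma along the multiples of [n] bounds [X n - M] in mean square. *)
Lemma integral_sqr_limit (X : nat -> T -> R) (M : T -> R) (v K : R) :
  (forall n, (0 < n)%N -> L2 (X n)) -> measurable_fun [set: T] M ->
  (forall n, (0 < n)%N -> `|\int[P]_w (X n w ^+ 2) - v| <= K / n%:R) ->
  (forall n j, (0 < n)%N -> (0 < j)%N ->
    \int[P]_w ((X n w - X (n * j)%N w) ^+ 2) <= K / n%:R ^+ 2) ->
  {ae P, forall w, X n w @[n --> \oo] --> M w} ->
  (\int[P]_w (M w ^+ 2)%:E = v%:E)%E.
Proof.
move=> X2 mM Xv XX XM.
have mXM n : (0 < n)%N -> measurable_fun [set: T] (fun w => X n w - M w).
  by move=> n0; apply: measurable_funB => //; have [] := X2 n n0.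
have XMK n : (0 < n)%N -> (\int[P]_w ((X n w - M w) ^+ 2)%:E <= (K / n%:R ^+ 2)%:E)%E.
  (* The successor keeps the index positive, as the hypotheses on [X] require. *)
  move=> n0; pose f j w := ((X n w - X (n * j.+1)%N w) ^+ 2)%:E.
  have nj0 j : (0 < n * j.+1)%N by rewrite muln_gt0 n0.
  have f2 j := L2B (X2 n n0) (X2 _ (nj0 j)).
  apply: (@le_trans _ _ (\int[P]_w limn_einf (f^~ w))%E).
    apply: ge0_ae_le_integral_measurable_left.
    - by apply/measurable_EFinP/measurable_funX/mXM.
    - by move=> w; rewrite lee_fin sqr_ge0.
    - move=> w; rewrite limn_einf_lim; apply: lime_ge; first exact: is_cvg_einfs.
      apply: nearW => k; apply: le_ereal_inf_tmp => _ [j _ <-].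
      by rewrite lee_fin sqr_ge0.
    - apply: filterS XM => w Xw.
      have /cvg_limn_einf_sup[-> _] : f j w @[j --> \oo] --> ((X n w - M w) ^+ 2)%:E.
        apply/cvg_EFin; first exact: nearW.
        have Xnj : X (n * j.+1)%N w @[j --> \oo] --> M w.
          apply: (@cvg_comp _ _ _ (fun j => (n * j.+1)%N) (X^~ w) _ \oo) => //.
          move=> A [N _ NA]; exists N => // j /= Nj; apply: NA => /=.
          by rewrite (leq_trans Nj)// (leq_trans (leqnSn j))// leq_pmull.
        by apply: cvgM; (apply: cvgB; [exact: cvg_cst|exact: Xnj]).
      exact: lexx.
  apply: (le_trans (fatou _ _ _ _)) => //.
  - by move=> j; apply/measurable_EFinP/measurable_funX; have [] := f2 j.
  - by move=> j w _; rewrite lee_fin sqr_ge0.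
  - apply: limn_einf_le => j.
    have := XX n j.+1 n0 isT; rewrite /Rintegral -lee_fin fineK//.
    by apply: integrable_fin_num => //; have [] := f2 j.
have D2 n : (0 < n)%N -> L2 (fun w => X n w - M w).
  move=> n0; split; first exact: mXM.
  apply/integrableP; split; first by apply/measurable_EFinP/measurable_funX/mXM.
  under eq_integral do rewrite gee0_abs ?lee_fin ?sqr_ge0//.
  exact: le_lt_trans (XMK n n0) (ltry _).
have M2 : L2 M.
  have := L2B (X2 1 isT) (D2 1 isT).
  by congr square_integrable; apply/funext => w; rewrite subKr.
have iM := integrable_fin_num measurableT M2.2.
rewrite -(fineK iM); congr EFin; apply/eqP; rewrite -subr_eq0; apply/eqP.
(* With [D = X n - M], the difference is [(E X^2 - v) - 2 E (X D) + E D^2], whose terms are at most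
   [K / n], [(v + 2 K) / n] and [K / n]. *)
apply: (le_div_nat_eq0 (K := v + 4 * K)) => n n0.
have nR : 1 <= n%:R :> R by rewrite ler1n.
have nR0 : 0 < n%:R :> R by rewrite ltr0n.
have hv := Xv n n0.
have hD : \int[P]_w ((X n w - M w) ^+ 2) <= K / n%:R ^+ 2.
  rewrite /Rintegral -lee_fin fineK ?XMK//.
  by apply: integrable_fin_num => //; have [] := D2 n n0.
have hm := Rintegral_mul_bound n0 (X2 n n0) (D2 n n0).
have hM : \int[P]_w (M w ^+ 2) = \int[P]_w (X n w ^+ 2) -
    2 * \int[P]_w (X n w * (X n w - M w)) + \int[P]_w ((X n w - M w) ^+ 2).
  have := RintegralD_sqr (X2 n n0) (L2Z (-1) (D2 n n0)).
  have -> : \int[P]_w (X n w * (-1 * (X n w - M w))) =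
      - \int[P]_w (X n w * (X n w - M w)).
    rewrite -[RHS]mulN1r -RintegralZl//; last exact: L2_integrableM (X2 n n0) (D2 n n0).
    by apply: eq_Rintegral => w _; rewrite mulrCA.
  under [in X in _ = _ + X -> _]eq_Rintegral do rewrite mulN1r sqrrN.
  under [in X in X = _ -> _]eq_Rintegral do rewrite mulN1r subKr.
  by rewrite mulrN.
have D0 : 0 <= \int[P]_w ((X n w - M w) ^+ 2).
  by apply: Rintegral_ge0 => w _; exact: sqr_ge0.
rewrite -/(Rintegral P setT _) hM.
move: hv hD hm D0; set x := \int[P]_w (X n w ^+ 2); set y := \int[P]_w _.
set z := 2 * _; move=> hv hD hm D0.
have K0 : 0 <= K / n%:R by exact: le_trans hv.
have Kn2 : K / n%:R ^+ 2 <= K / n%:R.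
  rewrite expr2 invfM mulrA ler_piMr// invf_le1//.
have nD : n%:R * y <= K / n%:R.
  have : n%:R * y <= n%:R * (K / n%:R ^+ 2) by rewrite ler_wpM2l.
  by congr (_ <= _); field; by rewrite gt_eqF.
have xn : x / n%:R <= v / n%:R + K / n%:R.
  have : x / n%:R <= (v + K / n%:R) / n%:R.
    by rewrite ler_wpM2r ?invr_ge0//; move: hv; rewrite ler_norml; lra.
  move=> /le_trans; apply; rewrite mulrDl lerD2l.
  by rewrite ler_piMr// invf_le1.
rewrite mulrDl.
move: hv hm; rewrite !ler_norml; lra.
Qed.

End square_mean_limit.

(** * Second moment of [M] at a fixed time *)

Section scaled_rate_moment.
Context d (T : measurableType d) (R : realType) (P : probability T R).
Variables (mu gamma sigma kappa : R) (V : {RV P >-> R}).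
Variables (B Y : R -> {RV P >-> R}).
Hypotheses (gamma_gt0 : 0 < gamma) (sigma_gt0 : 0 < sigma) (kappa_gt0 : 0 < kappa).
Hypothesis V_normal : has_normal_law P V mu gamma.
Hypothesis B_brownian : standard_brownian_motion B.
Hypothesis BV_independent : independent_systems P
  (sigma_process `[0, 1] B) (g_sigma_algebra_preimage V).
Hypothesis Y_equilibrium : equilibrium_demand mu gamma sigma kappa V B Y.
Local Notation L := (Lambda kappa).
Local Notation a := (bridge_kernel L).
Local Notation c := (1 - L ^+ 2)^-1.
Local Notation Z w := ((V w - mu) / gamma).
Local Notation M t w := (scaled_rate mu gamma sigma kappa (V w) (Y^~ w) t).

Let L_gt0 : 0 < L := Lambda_gt0 kappa.
Let L_lt1 : L < 1 := Lambda_lt1 kappa_gt0.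

Lemma measurable_scaled_rate t : measurable_fun [set: T] (fun w => M t w).
Proof.
apply: measurable_funM => //; apply: measurable_funB.
  by apply: measurable_funM => //; exact: measurable_funB.
by apply: measurable_funM => //; exact: measurable_funM.
Qed.

(** [Z] has second moment [1], the Riemann sums contribute [a t - 1] up to [O(1/n)], and the mixed
    term vanishes since [V] is independent of [B]. *)
Lemma integral_sqr_scaled_rate t : 0 <= t <= 1 ->
  (\int[P]_w (M t w ^+ 2)%:E = (a t)%:E)%E.
Proof.
move=> t01; have /andP[l0 l1] := sqrL_lt1 L_gt0 L_lt1.
have c1 : 1 <= c by rewrite invf_ge1 ?subr_gt0// gerBl ltW.
have c0 : 0 <= c := le_trans ler01 c1.
pose S := wiener_sum B t L.
have S2 n : (0 < n)%N -> square_integrable P (S n) by exact: L2_wiener_sum.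
have Z2 := L2_standardized gamma_gt0 V_normal.
(* [c ^+ 4] serves both bounds: the second moments are within [c^2 / n <= c^4 / n] since [c >= 1],
   and the refinement bound is [(c^2 / n)^2]. *)
apply: (integral_sqr_limit (X := fun n w => Z w - L * S n w) (K := c ^+ 4)).
- by move=> n n0; exact: L2B Z2 (L2Z L (S2 n n0)).
- exact: measurable_scaled_rate.
- move=> n n0.
  have := RintegralD_sqr Z2 (L2Z (- L) (S2 n n0)).
  have -> : \int[P]_w (Z w * (- L * S n w)) = 0.
    have := RintegralM_sum (fun k => a (grid t n k))
      (fun k => L2_grid_increment B_brownian t01 n0 (k := k)) (L2Z (- L) Z2).
    rewrite big_nat big1 => [h|k /andP[_ kn]].
      by rewrite -[RHS]h; apply: eq_Rintegral => w _; rewrite mulrCA mulrA mulrC.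
    apply/eqP; rewrite mulf_eq0; apply/orP; right; apply/eqP.
    have g0 := grid_ge0 t01 n k.
    have gk := grid_le t01 n (leqnSn k).
    have g1 := grid_le1 t01 n0 kn.
    have ZB := Rintegral_standardized_brownian B_brownian gamma_gt0
      V_normal BV_independent g0 gk g1.
    rewrite -[RHS](mulr0 (- L)) -ZB -RintegralZl//; last first.
      exact: L2_integrableM Z2 (L2_brownian_increment B_brownian g0 gk g1).
    by apply: eq_Rintegral => w _; rewrite mulrCA [_ * Z w]mulrC.
  rewrite mulr0 addr0 (Rintegral_sqr_standardized gamma_gt0 V_normal).
  have -> : \int[P]_w ((- L * S n w) ^+ 2) = L ^+ 2 * \int[P]_w (S n w ^+ 2).
    rewrite -RintegralZl//; last by have [] := S2 n n0.
    by apply: eq_Rintegral => w _; rewrite exprMn sqrrN.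
  under eq_Rintegral do rewrite mulNr.
  move=> ->.
  have /andP[] := Rintegral_sqr_wiener_sum_bounds B_brownian t01 L_gt0 L_lt1 n0.
  rewrite -/(S n) => h1 h2; rewrite ler_norml.
  have : c ^+ 2 / n%:R <= c ^+ 4 / n%:R.
    by rewrite ler_wpM2r ?invr_ge0 ?ler0n// ler_weXn2l.
  move: h1 h2; set x := c ^+ 2 / _; set y := c ^+ 4 / _; set e := L ^+ 2 * _ => *.
  by apply/andP; split; lra.
- move=> n j n0 j0; have nj0 : (0 < n * j)%N by rewrite muln_gt0 n0.
  have := Rintegral_sqr_wiener_sumB B_brownian t01 L_gt0 L_lt1 n0 j0.
  rewrite -/(S n) -/(S (n * j)%N) => h.
  have SS2 := L2B (S2 n n0) (S2 _ nj0).
  have -> : \int[P]_w ((Z w - L * S n w - (Z w - L * S (n * j)%N w)) ^+ 2) =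
      L ^+ 2 * \int[P]_w ((S n w - S (n * j)%N w) ^+ 2).
    rewrite -RintegralZl//; last exact: SS2.2.
    by apply: eq_Rintegral => w _; ring.
  have -> : c ^+ 4 / n%:R ^+ 2 = 1 * (c ^+ 2 / n%:R) ^+ 2.
    by rewrite mul1r [RHS]exprMn -[in RHS]exprM (exprVn n%:R).
  apply: ler_pM => //; [exact: ltW| |exact: ltW].
  by apply: Rintegral_ge0 => w _; exact: sqr_ge0.
- apply: filterS Y_equilibrium => w [Y0 cY YE].
  exact: (cvg_scaled_rate_riemann_sum (b := B^~ w)).
Qed.

End scaled_rate_moment.

(** * Tonelli for a process with almost surely continuous paths *)

Section continuous_process.
Context d (T : measurableType d) (R : realType) (P : probability T R).
Variable M : R -> T -> R.
Hypothesis mM : forall t, measurable_fun [set: T] (M t).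
Hypothesis cM : {ae P, forall w, {within `[0, 1], continuous (M^~ w)}}.
Local Notation leb := (@lebesgue_measure R).
Local Notation RT := (measurableTypeR R).

Definition left_grid_point n (t : R) : R := (Num.truncn (t * n%:R))%:R / n%:R.

Lemma left_grid_point01 n t : 0 <= t <= 1 -> 0 <= left_grid_point n t <= 1.
Proof.
move=> /andP[t0 t1]; rewrite /left_grid_point.
have [->|n0] := posnP n; first by rewrite invr0 mulr0 lexx ler01.
have nR : 0 < n%:R :> R by rewrite ltr0n.
rewrite divr_ge0//= ler_pdivrMr// mul1r.
have tn0 : 0 <= t * n%:R by rewrite mulr_ge0.
have /andP[h _] := truncn_itv tn0.
by apply: (le_trans h); rewrite ler_piMl.
Qed.

Lemma left_grid_point_dist n t : (0 < n)%N -> 0 <= t ->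
  `|t - left_grid_point n t| <= n%:R^-1.
Proof.
move=> n0 t0; have nR : 0 < n%:R :> R by rewrite ltr0n.
have tn0 : 0 <= t * n%:R by rewrite mulr_ge0.
have /andP[h1 h2] := truncn_itv tn0.
rewrite /left_grid_point.
have -> : t - (Num.truncn (t * n%:R))%:R / n%:R =
    (t * n%:R - (Num.truncn (t * n%:R))%:R) / n%:R by field; rewrite gt_eqF.
rewrite normrM (ger0_norm (_ : 0 <= n%:R^-1)) ?invr_ge0//.
rewrite ler_piMl ?invr_ge0// ger0_norm ?subr_ge0//.
by move: h2; rewrite -natr1; lra.
Qed.

Lemma measurable_truncn_eq k : measurable [set x : R | Num.truncn x = k].
Proof.
have trunc_gt m : measurable [set x : R | (m < Num.truncn x)%N].
  rewrite (_ : [set _ | _] = `[m.+1%:R, +oo[%classic)//.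
  by apply/seteqP; split => x /=; rewrite in_itv/= andbT truncn_gt_nat.
case: k => [|k].
  rewrite (_ : [set _ | _] = ~` [set x : R | (0 < Num.truncn x)%N]).
    exact: measurableC.
  by apply/seteqP; split => x /=; [move=> ->|move/negP; rewrite -eqn0Ngt => /eqP].
rewrite (_ : [set _ | _] = [set x : R | (k < Num.truncn x)%N] `&`
    ~` [set x : R | (k.+1 < Num.truncn x)%N]).
  by apply: measurableI => //; exact: measurableC.
apply/seteqP; split => x /=; first by move=> ->; rewrite ltnSn ltnn.
by move=> [kx /negP]; rewrite -leqNgt => xk; apply/eqP; rewrite eqn_leq xk.
Qed.

(** Frozen time takes countably many values, so a preimage is a countable union of rectangles;
    measurability in the outcome alone suffices. *)
Lemma measurable_left_grid n :
  measurable_fun [set: RT * T] (fun z => M (left_grid_point n z.1) z.2).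
Proof.
have mt : measurable_fun [set: RT * T] (fun z : RT * T => (z.1 : R) * n%:R).
  exact: measurable_funM.
move=> _ A mA; rewrite setTI.
have -> : (fun z : RT * T => M (left_grid_point n z.1) z.2) @^-1` A =
    \bigcup_k ([set z : RT * T | Num.truncn (z.1 * n%:R) = k] `&`
      (fun z : RT * T => M (k%:R / n%:R) z.2) @^-1` A).
  apply/seteqP; split => z /=.
    by exists (Num.truncn (z.1 * n%:R)).
  by move=> [k _ /= [<- ]].
apply: bigcup_measurable => k _; apply: measurableI.
  rewrite -[X in measurable X]setTI.
  exact: (mt measurableT _ (measurable_truncn_eq k)).
rewrite -[X in measurable X]setTI.
have mk : measurable_fun [set: RT * T] (M (k%:R / n%:R) \o snd).
  exact: measurableT_comp.
exact: mk.
Qed.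

(* A jointly measurable version of [M ^+ 2]; the upper limit makes it measurable
   even where paths are not continuous. *)
Definition jointly_measurable_sqr (z : RT * T) : \bar R :=
  limn_esup (fun n => (M (left_grid_point n z.1) z.2 ^+ 2)%:E).

Lemma measurable_jointly_measurable_sqr :
  measurable_fun [set: RT * T] jointly_measurable_sqr.
Proof.
apply: measurable_fun_limn_esup => n.
by apply/measurable_EFinP/measurable_funX; exact: measurable_left_grid.
Qed.

Lemma jointly_measurable_sqr_ge0 z : (0 <= jointly_measurable_sqr z)%E.
Proof.
rewrite /jointly_measurable_sqr limn_esup_lim; apply: lime_ge; first exact: is_cvg_esups.
apply: nearW => n; apply: ereal_sup_ge; exists (M (left_grid_point n z.1) z.2 ^+ 2)%:E.
  by exists n => /=.
by rewrite lee_fin sqr_ge0.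
Qed.

Lemma jointly_measurable_sqrE t w : {within `[0, 1], continuous (M^~ w)} ->
  0 <= t <= 1 -> jointly_measurable_sqr (t, w) = (M t w ^+ 2)%:E.
Proof.
move=> cw t01; rewrite /jointly_measurable_sqr.
have t01' : `[0, 1]%classic t by rewrite /= in_itv.
have Mt : M (left_grid_point n t) w @[n --> \oo] --> M t w.
  move/subspace_continuousP : cw => /(_ t t01') cw.
  apply: (@cvg_comp _ _ _ (fun n => left_grid_point n t) (M^~ w) _ _ _ _ cw).
  move=> A /nbhs_ballP[e /= e0 eA].
  near=> n; apply: eA; last by rewrite /= in_itv/= left_grid_point01.
  rewrite /ball/=; apply: le_lt_trans (left_grid_point_dist _ _) _.
  - by near: n; exact: nbhs_infty_gt.
  - by case/andP : t01.
  - rewrite invf_plt ?posrE ?ltr0n//; first by near: n; exact: nbhs_infty_gtr.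
    by near: n; exact: nbhs_infty_gt.
have /cvg_limn_einf_sup[_ ->] // : (M (left_grid_point n t) w ^+ 2)%:E @[n --> \oo] -->
  (M t w ^+ 2)%:E.
apply/cvg_EFin; first exact: nearW.
exact: cvgM.
Unshelve. all: by end_near. Qed.

(** The pathwise integral is not known to be measurable in the outcome, so a measurable [h] almost
    everywhere equal to it is supplied in its place. *)
Lemma tonelli_continuous_process (v : R -> R) :
  (forall t, 0 <= t <= 1 -> (\int[P]_w (M t w ^+ 2)%:E = (v t)%:E)%E) ->
  exists h : T -> \bar R,
  [/\ measurable_fun [set: T] h, forall w, (0 <= h w)%E,
      {ae P, forall w, h w = (\int[leb]_(t in `[0%R, 1%R]) (M t w ^+ 2)%:E)%E} &
      (\int[P]_w h w = \int[leb]_(t in `[0%R, 1%R]) (v t)%:E)%E].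
Proof.
move=> Mv.
pose g (z : RT * T) := (jointly_measurable_sqr z * (\1_(`[0, 1]%classic : set RT) z.1)%:E)%E.
have g0 z : (0 <= g z)%E by rewrite mule_ge0 ?jointly_measurable_sqr_ge0// lee_fin.
have mg : measurable_fun [set: RT * T] g.
  apply: emeasurable_funM; first exact: measurable_jointly_measurable_sqr.
  have mI : measurable_fun [set: RT] (\1_(`[0, 1]%classic : set RT) : RT -> R).
    exact: measurable_indic.
  have mI1 : measurable_fun [set: RT * T] ((\1_(`[0, 1]%classic : set RT) : RT -> R) \o fst).
    exact: measurableT_comp.
  exact/measurable_EFinP.
have gE w : {within `[0, 1], continuous (M^~ w)} ->
    (\int[leb]_t g (t, w) = \int[leb]_(t in `[0%R, 1%R]) (M t w ^+ 2)%:E)%E.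
  move=> cw; rewrite [RHS]integral_mkcond; apply: eq_integral => t _.
  rewrite /g patchE indicE /=; case: ifPn => t01; last by rewrite mule0.
  by rewrite mule1 jointly_measurable_sqrE//; move: t01; rewrite inE/= in_itv.
exists (fun w => \int[leb]_t g (t, w))%E; split.
- exact: (measurable_fun_fubini_tonelli_G (m1 := leb) g mg g0).
- by move=> w; exact: integral_ge0.
- by apply: filterS cM => w; exact: gE.
- rewrite -(fubini_tonelli (m1 := leb) (m2 := P) g mg g0).
  rewrite [RHS]integral_mkcond; apply: eq_integral => t _.
  rewrite patchE; case: ifPn => t01.
    have t01' : 0 <= t <= 1 by move: t01; rewrite inE/= in_itv.
    rewrite -Mv//; apply: ge0_ae_eq_integral_measurable.
    + by apply/measurable_EFinP/measurable_funX.
    + by move=> w; rewrite lee_fin sqr_ge0.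
    + by [].
    + apply: filterS cM => w cw.
      by rewrite /g indicE /= t01 mule1 jointly_measurable_sqrE.
  rewrite integral0_eq// => w _; rewrite /g indicE /=.
  by move: t01 => /negbTE ->; rewrite mule0.
Qed.

End continuous_process.

(** The antiderivative [F] is differentiable on [t < L ^- 2], an open half-line containing [[0, 1]]
    because [L < 1], so the end points need no separate argument. *)
Lemma integral_bridge_kernel (R : realType) (L : R) : 0 < L -> L < 1 ->
  (\int[lebesgue_measure]_(t in `[0%R, 1%R]) (bridge_kernel L t)%:E =
   (- ln (1 - L ^+ 2) / L ^+ 2)%:E)%E.
Proof.
move=> L0 L1; have /andP[l0 l1] := sqrL_lt1 L0 L1.
have den t : t < L ^- 2 -> 0 < 1 - t * L ^+ 2.
  by move=> tL; rewrite subr_gt0 -ltr_pdivlMr// div1r.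
have lV : 1 < L ^- 2 by rewrite invf_gt1.
pose F t : R := - ln (1 - t * L ^+ 2) / L ^+ 2.
have dF (t : R) : t < L ^- 2 -> is_derive t 1 F (bridge_kernel L t).
  move=> tL; have dt := den t tL.
  have H : is_derive t 1 (fun x : R => ln (1 - x * L ^+ 2)) ((1 - t * L ^+ 2)^-1 * (- L ^+ 2)).
    apply: (@is_derive1_comp _ (@ln R) (fun x : R => 1 - x * L ^+ 2)).
      exact: is_derive1_ln.
    have -> : (fun x : R => 1 - x * L ^+ 2) = cst 1 - L ^+ 2 *: id.
      by apply/funext => x; rewrite /= !fctE /GRing.scale/= mulrC.
    by apply: is_derive_eq; rewrite /GRing.scale/= mulr1 sub0r.
  have -> : F = (- (L ^- 2)) *: (fun x : R => ln (1 - x * L ^+ 2)).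
    by apply/funext => x; rewrite /F !fctE /GRing.scale/= mulNr mulrC mulNr.
  apply: is_derive_eq; rewrite /GRing.scale/= /bridge_kernel.
  by field; rewrite !gt_eqF.
have cF (t : R) : t < L ^- 2 -> F x @[x --> t] --> F t.
  move=> tL; apply/differentiable_continuous/derivable1_diffP.
  by case: (dF t tL).
rewrite (@continuous_FTC2 R _ F 0 1)//.
- by rewrite /F mul0r subr0 ln1 oppr0 mul0r mul1r sube0.
- apply/continuous_in_subspaceT => x /[!inE]/=; rewrite in_itv/= => x01.
  apply: cvgV; first by rewrite gt_eqF// bridge_denominator_gt0.
  by apply: cvgB; [exact: cvg_cst|apply: cvgMl; exact: cvg_id].
- split.
  + move=> x; rewrite in_itv/= => /andP[_ x1].
    by case: (dF x (lt_trans x1 lV)).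
  + by apply: cvg_at_right_filter; apply: cF; exact: lt_trans lV.
  + by apply: cvg_at_left_filter; exact: cF.
- move=> x; rewrite in_itv/= => /andP[_ x1]; rewrite derive1E.
  by have /@derive_val := dF x (lt_trans x1 lV).
Qed.

(** * The value of the expected penalty *)

Section equilibrium_penalty.
Context d (T : measurableType d) (R : realType) (P : probability T R).
Variables (mu gamma sigma kappa : R) (V : {RV P >-> R}).
Variables (B Y : R -> {RV P >-> R}).
Hypotheses (gamma_gt0 : 0 < gamma) (sigma_gt0 : 0 < sigma) (kappa_gt0 : 0 < kappa).
Hypothesis V_normal : has_normal_law P V mu gamma.
Hypothesis B_brownian : standard_brownian_motion B.
Hypothesis BV_independent : independent_systems P
  (sigma_process `[0, 1] B) (g_sigma_algebra_preimage V).
Hypothesis Y_equilibrium : equilibrium_demand mu gamma sigma kappa V B Y.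
Local Notation L := (Lambda kappa).
Local Notation leb := (@lebesgue_measure R).

Lemma expected_penaltyE : expected_penalty mu gamma sigma kappa V Y =
  (gamma * sigma / 2 * penalty_profile kappa)%:E.
Proof.
have L0 := Lambda_gt0 kappa; have L1 := Lambda_lt1 kappa_gt0.
pose M t w := scaled_rate mu gamma sigma kappa (V w) (Y^~ w) t.
have cM : {ae P, forall w, {within `[0, 1], continuous (M^~ w)}}.
  apply: filterS Y_equilibrium => w [_ cY _].
  exact: continuous_scaled_rate.
have mM t : measurable_fun [set: T] (M t) by exact: measurable_scaled_rate.
have Mv t : 0 <= t <= 1 -> (\int[P]_w (M t w ^+ 2)%:E = (bridge_kernel L t)%:E)%E.
  by move=> t01; exact: (integral_sqr_scaled_rate (B := B)).
have [h [mh h0 hM hI]] := tonelli_continuous_process mM cM Mv.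
pose k := penalty_rate gamma sigma kappa / 2 * (L * sigma) ^+ 2.
have r0 : 0 <= penalty_rate gamma sigma kappa / 2.
  by rewrite divr_ge0// mulr_ge0 ?divr_ge0 ?(ltW kappa_gt0) ?(ltW gamma_gt0) ?(ltW sigma_gt0).
have k0 : 0 <= k by rewrite mulr_ge0 ?sqr_ge0.
rewrite /expected_penalty unlock.
(* The integrand of the expectation is traded for a measurable one; [k] collects half the penalty
   rate and the square of the factor [L * sigma] between [M] and the trading rate. *)
rewrite (ge0_ae_eq_integral_measurable (f := fun w => k%:E * h w)%E).
- rewrite ge0_integralZl// hI integral_bridge_kernel// -EFinM; congr EFin.
  rewrite /k /penalty_rate /penalty_profile mul_Lambda.
  by field; rewrite (gt_eqF sigma_gt0) (gt_eqF L0).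
- exact: emeasurable_funM.
- by move=> w; rewrite mule_ge0.
- move=> w; rewrite lee_fin mulr_ge0//; apply: Rintegral_ge0 => t _.
  exact: sqr_ge0.
- apply: filterS2 hM cM => w -> cMw.
  have iM2 : leb.-integrable `[0, 1] (EFin \o (fun t => M t w ^+ 2)).
    apply: continuous_compact_integrable; first exact: segment_compact.
    by move=> t; apply: cvgM; exact: cMw.
  have -> : (\int[leb]_(t in `[0%R, 1%R]) (M t w ^+ 2)%:E)%E =
      (\int[leb]_(t in `[0, 1]) (M t w ^+ 2))%:E.
    by rewrite /Rintegral fineK//; exact: integrable_fin_num.
  rewrite -EFinM; congr EFin; rewrite /k -[RHS]mulrA; congr (_ * _).
  rewrite -RintegralZl//; apply: eq_Rintegral => t _.
  by rewrite -exprMn (trading_rateE _ _ _ _ _ (Y^~ w)).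
Qed.

End equilibrium_penalty.

(** The formula is stated for the extended real [EP], so finiteness is part of it and [fine] in
    [Pen] loses nothing for positive [kappa]. The witness for [kappa0] is [inflection]. *)
Theorem corollary5p5 (R : realType) (d : measure_display) (T : measurableType d)
    (P : probability T R) (mu gamma sigma : R)
    (V : {RV P >-> R}) (B : R -> {RV P >-> R}) (Y : R -> R -> {RV P >-> R})
    (gamma_gt0 : 0 < gamma) (sigma_gt0 : 0 < sigma)
    (V_normal : has_normal_law P V mu gamma)
    (B_brownian : standard_brownian_motion B)
    (BV_independent : independent_systems P
       (sigma_process `[0, 1] B) (g_sigma_algebra_preimage V))
    (Y_equilibrium : forall kappa : R, 0 < kappa ->
       equilibrium_demand mu gamma sigma kappa V B (Y kappa)) :
  let EP (kappa : R) : \bar R :=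
    expected_penalty mu gamma sigma kappa V (Y kappa) in
  let Pen (kappa : R) : R := fine (EP kappa) in
  (forall kappa : R, 0 < kappa ->
     EP kappa = (- (gamma * sigma / 2) * kappa * ln (kappa * Lambda kappa))%:E)
  /\ (exists2 kappa0 : R, 0 < kappa0 &
        convex_function (`]0, kappa0[ : set R) (fun kappa => - Pen kappa) /\
        convex_function (`]kappa0, +oo[ : set R) Pen)
  /\ (forall kappa : R, 0 < kappa -> `|Pen kappa| <= gamma * sigma / 2)
  /\ Pen kappa @[kappa --> 0^'+] --> 0
  /\ Pen kappa @[kappa --> +oo] --> 0.
Proof.
move=> EP Pen.
have EPE kappa : 0 < kappa -> EP kappa = (gamma * sigma / 2 * penalty_profile kappa)%:E.
  move=> kappa0; apply: (expected_penaltyE (B := B)) => //.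
  exact: Y_equilibrium.
have PenE kappa : 0 < kappa -> Pen kappa = gamma * sigma / 2 * penalty_profile kappa.
  by move=> kappa0; rewrite /Pen EPE.
have gs0 : 0 <= gamma * sigma / 2 by rewrite divr_ge0// mulr_ge0 ?ltW.
have i0 := @inflection_gt0 R.
split.
  by move=> kappa kappa0; rewrite EPE// /penalty_profile; congr EFin; ring.
split.
  exists inflection => //; split.
    apply: (eq_convex_function_itv (f := fun k => gamma * sigma / 2 * - penalty_profile k)).
      by move=> k; rewrite in_itv/= => /andP[k0 _]; rewrite PenE// mulrN.
    exact/convex_function_scale/concave_penalty_profile.
  apply: (eq_convex_function_itv (f := fun k => gamma * sigma / 2 * penalty_profile k)).
    by move=> k; rewrite in_itv/= andbT => ik; rewrite PenE//; exact: lt_trans ik.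
  exact/convex_function_scale/convex_penalty_profile.
split.
  move=> kappa kappa0; rewrite PenE// ger0_norm; last first.
    exact/(mulr_ge0 gs0)/penalty_profile_ge0.
  by rewrite ler_piMr// penalty_profile_le1.
have scaled_to0 (F : set_system R) : Filter F ->
    @penalty_profile R k @[k --> F] --> 0 ->
    gamma * sigma / 2 * @penalty_profile R k @[k --> F] --> 0.
  by move=> FF; rewrite -[X in _ -> _ --> X](mulr0 (gamma * sigma / 2)); exact: cvgMr.
split.
  apply: cvg_trans (scaled_to0 _ _ cvg_penalty_profile_at_right0).
  apply: near_eq_cvg; near=> k; have k0 : 0 < k by near: k; exact: nbhs_right_gt.
  by rewrite /= PenE.
apply: cvg_trans (scaled_to0 _ _ cvg_penalty_profile_pinfty).
apply: near_eq_cvg; near=> k; have k0 : 0 < k by near: k; exact: nbhs_pinfty_gt.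
by rewrite /= PenE.
Unshelve. all: by end_near. Qed.
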